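(* Let $p\in(0,1)$ be a fixed constant. For an even integer $n=2s$, let $M$ be the $n\times n$ matrix with $m_{ij}=p$ if $1\le|i-j|\le s-1$ and $0$ otherwise, and let $\widehat M$ be a random symmetric $n\times n$ matrix with zero diagonal whose entries $\widehat m_{ij}$, $i<j$, are independent Bernoulli variables with $\mathbb P(\widehat m_{ij}=1)=m_{ij}$. Let $u\in\mathbb R^n$ be given by $u_j=\cos\left(\frac{(2j-1)\pi}{4s+2}\right)$ for $j=1,\dots,s$ and $u_j=-u_{n-j+1}$ for $j=s+1,\dots,n$, and let $y$ be a unit eigenvector of $\widehat M$ for $\lambda_2(\widehat M)$ with sign chosen so that $\langle y,u\rangle\ge0$. Then there is a constant $C>0$ (independent of $n$) such that, with probability at least $1-n^{-3}$, $D(\sigma_y)\le Cn^{9/5}$; i.e. $D(\sigma_y)=\mathcal O(n^{9/5})$ with probability $1-n^{-3}$.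
   Context: Eigenvalues of a symmetric matrix $X$ are labelled so that $|\lambda_1(X)|\ge|\lambda_2(X)|\ge\dots$; $\lambda_2(X)$ is the one of second largest absolute value. For $y\in\mathbb R^n$, $\sigma_y$ is a permutation of $\{1,\dots,n\}$ with $y_{\sigma_y(1)}\ge y_{\sigma_y(2)}\ge\dots\ge y_{\sigma_y(n)}$, and for a permutation $\sigma$ the Kendall distance is $D(\sigma)=\sum_{i<j}\mathbf 1_{\sigma(i)>\sigma(j)}$. *)

(* Defs.v *)
From HB Require Import structures.
From mathcomp Require Import all_boot all_order all_algebra all_fingroup.
From mathcomp Require Import all_classical all_reals all_analysis.



Unset Printing Implicit Defensive.

Import Order.TTheory GRing.Theory Num.Theory.
Local Open Scope ring_scope.

Section Defs.
Variable R : realType.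

Definition ndist (i j : nat) : nat := ((i - j) + (j - i))%N.

Definition Mmodel (p : R) (s : nat) : 'M[R]_(s.*2) :=
  \matrix_(i, j) (if (1 <= ndist i j <= s.-1)%N then p else 0).

(* Sample space: boolean matrices B; only the entries B i j with i < j are
   random (independent Bernoulli(m_ij)); the other entries are almost surely
   false.  Probability weight of an outcome B: *)
Definition weight (p : R) (s : nat) (B : 'M[bool]_(s.*2)) : R :=
  \prod_(i < s.*2) \prod_(j < s.*2)
     (if (i < j)%N then (if B i j then Mmodel p s i j else 1 - Mmodel p s i j)
      else (if B i j then 0 else 1)).

Definition Mhat (s : nat) (B : 'M[bool]_(s.*2)) : 'M[R]_(s.*2) :=
  \matrix_(i, j) (if (i < j)%N then (B i j)%:R
                  else if (j < i)%N then (B j i)%:R else 0).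

Definition Prob (p : R) (s : nat) (E : 'M[bool]_(s.*2) -> Prop) : R :=
  \sum_(B | `[< E B >]) weight p s B.

(* lam is a possible value of lambda_2(X): the eigenvalues of X (with
   multiplicity, i.e. the roots of the characteristic polynomial) listed as
   lambda_1, lambda_2, ... with |lambda_1| >= |lambda_2| >= ..., and lam is
   the second one. *)
Definition is_lambda2 (n : nat) (X : 'M[R]_n) (lam : R) : Prop :=
  exists sp : seq R,
    char_poly X = \prod_(x <- sp) ('X - x%:P) /\
    sorted (fun a b => `|b| <= `|a|) sp /\
    lam = sp`_1.

(* The vector u (0-based index i corresponds to j = i+1). *)
Definition uvec (s : nat) : 'cV[R]_(s.*2) :=
  \col_i (if (i < s)%N then cos (((2 * i + 1)%N%:R * pi) / (4 * s + 2)%N%:R)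
          else - cos (((2 * (s.*2 - 1 - i) + 1)%N%:R * pi) / (4 * s + 2)%N%:R)).

Definition sorts_desc (n : nat) (y : 'cV[R]_n) (sigma : 'S_n) : Prop :=
  forall i j : 'I_n, (i <= j)%N -> y (sigma j) 0 <= y (sigma i) 0.

End Defs.

Definition kendall (n : nat) (sigma : 'S_n) : nat :=
  #|[set ij : 'I_n * 'I_n | (ij.1 < ij.2)%N && (sigma ij.2 < sigma ij.1)%N]|.

(* Main.v *)
Require Import Defs.
From HB Require Import structures.
From mathcomp Require Import all_boot all_order all_algebra all_fingroup.
From mathcomp Require Import all_classical all_reals all_analysis.
From mathcomp Require Import ring lra zify.
Set Implicit Arguments.
Unset Strict Implicit.
Unset Printing Implicit Defensive.
Import Order.TTheory GRing.Theory Num.Theory numFieldNormedType.Exports.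
Local Open Scope ring_scope.

(* The vector [u] is an exact eigenvector of [M], with eigenvalue close to [pn/pi]. The
   Frobenius norm of [M] is so small that, given this eigenvalue and the Rayleigh quotient
   [3n/4 p] at the constant vector, [M - lam] is bounded below by a multiple of [n] on the
   complement of [u] for every [lam] that [lambda_2] of the perturbed matrix can be.
   With [E = Mhat - M] this gives [|y - u/|u|| = O(|E u| / (n |u|))] as soon as [|E|] is a
   small multiple of [n].

   The random inputs are union bounds over exponential moments of linear forms in [E]:
   the cut norm of [E] is a small multiple of [n^2], whence [|E|] is one of [n], since
   [tr E^4] is a sum of [n^2] bilinear forms of [E] at its own columns; and
   [|E u|^2 = O(n |u|^2)] by a union bound over integer vectors. So
   [|y - u/|u||^2 = O(1/n)].

   An inverted pair [a < b] with [y_a <= y_b] either has an entry displaced by at least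
   [t], which happens for at most [O(1/(n t^2))] indices, or, since the entries of [u/|u|]
   are separated by [(b-a)^2 / n^(5/2)], satisfies [b - a = O(n^(5/4) t^(1/2))]. The choice
   [t = n^(-9/10)] balances both contributions at [n^(9/5)]. *)

(** * Concentration of the noise *)

Section Concentration.
Variables (R : realType) (p : R) (s : nat).
Hypotheses (p_ge0 : 0 <= p) (p_le1 : p <= 1).
Local Notation n := (s.*2).
Local Notation m := (Mmodel R p s).
Implicit Type B : 'M[bool]_n.

Definition noise B : 'M[R]_n := Mhat R s B - m.

Lemma Mmodel_ge0 i j : 0 <= m i j.
Proof. by rewrite mxE; case: ifP. Qed.

Lemma Mmodel_le1 i j : m i j <= 1.
Proof. by rewrite mxE; case: ifP. Qed.

Lemma ndistC i j : ndist i j = ndist j i.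
Proof. by rewrite /ndist addnC. Qed.

Lemma MmodelC (i j : 'I_n) : m i j = m j i.
Proof. by rewrite !mxE ndistC. Qed.

Lemma MhatC B i j : Mhat R s B i j = Mhat R s B j i.
Proof. by rewrite !mxE; case: ltngtP. Qed.

Lemma noiseE B i j : noise B i j = Mhat R s B i j - m i j.
Proof. by rewrite [LHS]mxE [X in _ + X]mxE. Qed.

Lemma noiseC B i j : noise B i j = noise B j i.
Proof. by rewrite !noiseE MhatC MmodelC. Qed.

Lemma noise_lt B (i j : 'I_n) : (i < j)%N -> noise B i j = (B i j)%:R - m i j.
Proof. by move=> ij; rewrite !mxE ij. Qed.

Lemma noise_diag B i : noise B i i = 0.
Proof. by rewrite !mxE ltnn /ndist subnn subr0. Qed.

Lemma Mhat_01 B i j : Mhat R s B i j = (0 < Mhat R s B i j)%R%:R.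
Proof.
rewrite mxE; case: ifP => _; last case: ifP => _; last by rewrite ltxx.
  by case: (B i j); rewrite ?ltr01 ?ltxx.
by case: (B j i); rewrite ?ltr01 ?ltxx.
Qed.

Lemma noise_max B i j : `|noise B i j| <= 1.
Proof.
have := Mmodel_ge0 i j; have := Mmodel_le1 i j.
rewrite noiseE Mhat_01 ler_norml; case: (_ < _) => /= ? ?;
  apply/andP; split; lra.
Qed.

(** Independence of the entries, in the form of distributivity: with the weights absorbed into [F],
    a mean of products factors into a product of means. *)
Lemma sum_mx_prod (F : 'I_n -> 'I_n -> bool -> R) :
  \sum_(B : 'M[bool]_n) \prod_i \prod_j F i j (B i j) =
  \prod_i \prod_j (F i j true + F i j false).
Proof.
rewrite pair_bigA /=.
under [RHS]eq_bigr => ij _.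
  rewrite (_ : _ + _ = \sum_(b : bool) F ij.1 ij.2 b); last by rewrite big_bool.
  over.
rewrite bigA_distr_bigA /=.
rewrite (reindex (fun B : 'M[bool]_n => [ffun ij : 'I_n * 'I_n => B ij.1 ij.2])) /=.
  apply: eq_bigr => B _; rewrite pair_bigA /=.
  by apply: eq_bigr => ij _; rewrite ffunE.
exists (fun f : {ffun 'I_n * 'I_n -> bool} => \matrix_(i, j) f (i, j)).
  by move=> B _; apply/matrixP => i j; rewrite mxE ffunE.
by move=> f _; apply/ffunP => -[i j]; rewrite ffunE mxE.
Qed.

Lemma weight_ge0 B : 0 <= weight R p s B.
Proof.
apply: prodr_ge0 => i _; apply: prodr_ge0 => j _.
have := Mmodel_ge0 i j; have := Mmodel_le1 i j.
by case: (_ < _)%N; case: (B i j) => ? ?; lra.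
Qed.

Lemma sum_weight : \sum_B weight R p s B = 1.
Proof.
rewrite (sum_mx_prod (fun i j (b : bool) => if (i < j)%N
  then (if b then m i j else 1 - m i j) else (if b then 0 else 1))).
rewrite big1 // => i _; rewrite big1 // => j _; case: ifP => _; lra.
Qed.

(* Markov's inequality and the union bound at once: [f] dominates the indicator
   of the complement of [E]. *)
Lemma Prob_ge (E : 'M[bool]_n -> Prop) (f : 'M[bool]_n -> R) :
  (forall B, 0 <= f B) -> (forall B, E B \/ 1 <= f B) ->
  1 - \sum_B weight R p s B * f B <= Prob R p s E.
Proof.
move=> f0 Ef; rewrite /Prob -sum_weight lerBlDr.
rewrite [X in _ <= X + _]big_mkcond /= -big_split /=; apply: ler_sum => B _.
have w0 := weight_ge0 B; have fB0 := f0 B; case: ifP => [_|/negbT].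
  by rewrite lerDl mulr_ge0.
move/asboolPn => nE; case: (Ef B) => // f1; rewrite add0r -[leLHS]mulr1.
by rewrite ler_wpM2l.
Qed.

(** The linear term stays on the right because it averages out for a centred variable. Up to
    [x = 1/2] the bound follows from [expR x * (1 - x) <= 1], beyond that from [x <= 2 * x ^+ 2]. *)
Lemma expR_le_addr_sqr (x : R) : expR x <= x + expR (2 * x ^+ 2).
Proof.
have e1 := expR_ge1Dx (2 * x ^+ 2); have e2 := expR_ge1Dx (- x).
have e0 := expR_gt0 x; have e3 : expR x * (1 - x) <= 1.
  by rewrite -[leRHS](expRxMexpNx_1 x) ler_wpM2l // ltW.
have [x0|x0] := leP x 0.
  have : expR x <= 1 + x + x ^+ 2; last by nra.
  rewrite -(ler_pM2r (_ : 0 < 1 - x)); last by lra.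
  apply: (le_trans e3); nra.
have [x1|x1] := leP x (1 / 2).
  have : expR x <= 1 + x + 2 * x ^+ 2; last by nra.
  rewrite -(ler_pM2r (_ : 0 < 1 - x)); last by lra.
  apply: (le_trans e3); nra.
rewrite -[leLHS]add0r lerD // ?ler_expR ?ltW //; nra.
Qed.

Lemma bernoulli_mgf (q t : R) : 0 <= q <= 1 ->
  q * expR (t * (1 - q)) + (1 - q) * expR (t * (0 - q)) <= expR (2 * t ^+ 2).
Proof.
move=> /andP[q0 q1].
have a1 : expR (2 * (t * (1 - q)) ^+ 2) <= expR (2 * t ^+ 2).
  rewrite ler_expR exprMn ler_wpM2l // ler_piMr ?sqr_ge0 //; nra.
have a2 : expR (2 * (t * (0 - q)) ^+ 2) <= expR (2 * t ^+ 2).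
  rewrite ler_expR exprMn ler_wpM2l // ler_piMr ?sqr_ge0 //; nra.
have := expR_le_addr_sqr (t * (1 - q)); have := expR_le_addr_sqr (t * (0 - q)).
by nra.
Qed.

Lemma sum_offdiag (f : 'I_n -> 'I_n -> R) : (forall i, f i i = 0) ->
  \sum_i \sum_j f i j = \sum_(i < n) \sum_(j < n | (i < j)%N) (f i j + f j i).
Proof.
move=> f0; under [RHS]eq_bigr do rewrite big_split /=.
rewrite big_split /=.
rewrite [X in _ + X](exchange_big_dep predT) //= -big_split /=.
apply: eq_bigr => i _; rewrite (bigID (fun j : 'I_n => (i < j)%N)) /=.
congr (_ + _); rewrite (bigD1 i) /= ?ltnn // f0 add0r.
by apply: eq_bigl => j; rewrite -leqNgt [RHS]ltn_neqAle andbC.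
Qed.

(** [C] need not be symmetric: the entries at [(i, j)] and [(j, i)] are one random variable, with
    coefficient [C i j + C j i], and [(a + b)^2 <= 2 (a^2 + b^2)] turns the constant 2 of
    [bernoulli_mgf] into 4. *)
Lemma noise_mgf (C : 'I_n -> 'I_n -> R) :
  \sum_B weight R p s B * expR (\sum_i \sum_j C i j * noise B i j) <=
  expR (4 * \sum_i \sum_j C i j ^+ 2).
Proof.
pose F (i j : 'I_n) (b : bool) := if (i < j)%N
  then (if b then m i j else 1 - m i j) * expR ((C i j + C j i) * (b%:R - m i j))
  else (if b then 0 else 1).
have -> : \sum_B weight R p s B * expR (\sum_i \sum_j C i j * noise B i j) =
          \sum_(B : 'M[bool]_n) \prod_i \prod_j F i j (B i j).
  apply: eq_bigr => B _; rewrite sum_offdiag; last by move=> i; rewrite noise_diag mulr0.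
  rewrite expR_sum -big_split /=; apply: eq_bigr => i _.
  rewrite expR_sum [X in _ * X]big_mkcond -big_split /=; apply: eq_bigr => j _.
  rewrite /F; case: ifP => [ij|_]; last by rewrite mulr1.
  by rewrite (noiseC B j i) (noise_lt _ ij) -mulrDl.
rewrite sum_mx_prod.
apply: (@le_trans _ _ (\prod_(i < n) \prod_(j < n | (i < j)%N) expR (2 * (C i j + C j i) ^+ 2))).
  have b0 i j : 0 <= F i j true + F i j false <=
      if (i < j)%N then expR (2 * (C i j + C j i) ^+ 2) else 1.
    have m0 := Mmodel_ge0 i j; have m1 := Mmodel_le1 i j.
    rewrite /F; case: ifP => _; last by rewrite add0r ler01 lexx.
    rewrite addr_ge0 ?mulr_ge0 ?expR_ge0 ?subr_ge0 //= .
    by apply: bernoulli_mgf; rewrite m0.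
  apply: ler_prod => i _; apply/andP; split.
    by apply: prodr_ge0 => j _; have /andP[] := b0 i j.
  by rewrite [leRHS]big_mkcond; apply: ler_prod => j _; exact: b0.
under eq_bigr do rewrite -expR_sum.
rewrite -expR_sum ler_expR.
have h (g : 'I_n -> 'I_n -> R) : (forall i j, 0 <= g i j) ->
    \sum_(i < n) \sum_(j < n | (i < j)%N) (g i j + g j i) <= \sum_i \sum_j g i j.
  move=> g0; have -> : \sum_(i < n) \sum_(j < n | (i < j)%N) (g i j + g j i) =
      \sum_i \sum_j (if i == j then 0 else g i j).
    rewrite sum_offdiag => [|i]; last by rewrite eqxx.
    apply: eq_bigr => i _; apply: eq_bigr => j ij.
    have /negbTE ne : i != j by apply: contraTneq ij => ->; rewrite ltnn.
    by rewrite (eq_sym j) ne.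
  by apply: ler_sum => i _; apply: ler_sum => j _; case: ifP.
apply: (@le_trans _ _ (4 * \sum_(i < n) \sum_(j < n | (i < j)%N) (C i j ^+ 2 + C j i ^+ 2))).
  rewrite mulr_sumr; apply: ler_sum => i _; rewrite mulr_sumr; apply: ler_sum => j _.
  have := sqr_ge0 (C i j - C j i); nra.
by rewrite ler_pM2l //; apply: h => i j; exact: sqr_ge0.
Qed.

(** Chernoff form: for [t >= 0] the exponential is at least 1 wherever the linear form reaches the
    level [a]. *)
Lemma noise_mgf_tilt (C : 'I_n -> 'I_n -> R) (t a V : R) :
  \sum_i \sum_j C i j ^+ 2 <= V ->
  \sum_B weight R p s B * expR (t * \sum_i \sum_j C i j * noise B i j - t * a) <=
  expR (4 * t ^+ 2 * V - t * a).
Proof.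
move=> hV; rewrite expRD; under eq_bigr do rewrite expRD mulrA.
rewrite -mulr_suml ler_wpM2r ?expR_ge0 //.
have := noise_mgf (fun i j => t * C i j).
have -> : \sum_i \sum_j (t * C i j) ^+ 2 = t ^+ 2 * \sum_i \sum_j C i j ^+ 2.
  rewrite mulr_sumr; apply: eq_bigr => i _; rewrite mulr_sumr.
  by apply: eq_bigr => j _; rewrite exprMn.
have -> : \sum_B weight R p s B * expR (\sum_i \sum_j t * C i j * noise B i j) =
    \sum_B weight R p s B * expR (t * \sum_i \sum_j C i j * noise B i j).
  apply: eq_bigr => B _; congr (_ * expR _); rewrite mulr_sumr; apply: eq_bigr => i _.
  by rewrite mulr_sumr; apply: eq_bigr => j _; rewrite mulrA.
by move/le_trans; apply; rewrite ler_expR; have := sqr_ge0 t; nra.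
Qed.

(** The union bound as one function: a single pair of sets whose cut exceeds [a] in absolute value
    already contributes a term of at least 1. The sign [b] accounts for the absolute value. *)
Definition cut_bad (t a : R) B : R :=
  \sum_(ST : {set 'I_n} * {set 'I_n}) \sum_(b : bool)
    expR (t * (\sum_i \sum_j ((-1) ^+ b * (i \in ST.1)%:R * (j \in ST.2)%:R)
                 * noise B i j) - t * a).

Lemma cut_bad_ge0 t a B : 0 <= cut_bad t a B.
Proof. by do 2![apply: sumr_ge0 => ? _]; exact: expR_ge0. Qed.

Lemma cut_badP t a B : 0 <= t -> cut_bad t a B < 1 -> forall S T : {set 'I_n},
  `|\sum_i \sum_j (i \in S)%:R * (j \in T)%:R * noise B i j| <= a.
Proof.
move=> t0; rewrite ltNge => /negP H S T; rewrite leNgt; apply/negP => aS; apply: H.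
pose x := \sum_i \sum_j (i \in S)%:R * (j \in T)%:R * noise B i j.
have hb (b : bool) : \sum_i \sum_j ((-1) ^+ b * (i \in S)%:R * (j \in T)%:R) * noise B i j
     = (-1) ^+ b * x.
  rewrite mulr_sumr; apply: eq_bigr => i _; rewrite mulr_sumr; apply: eq_bigr => j _.
  by rewrite !mulrA.
apply: (@le_trans _ _ (expR (t * `|x| - t * a))).
  by rewrite -[leLHS](expR0 R) ler_expR subr_ge0 ler_wpM2l // ltW.
rewrite /cut_bad (bigD1 (S, T)) //= (bigD1 (x < 0)) //= hb -addrA -normrEsign.
by rewrite lerDl addr_ge0 // ?sumr_ge0 // => *; rewrite ?sumr_ge0 // => *; exact: expR_ge0.
Qed.

Lemma expR1_ge2 : 2 <= expR 1 :> R.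
Proof. by have := expR_ge1Dx (1 : R); lra. Qed.

Lemma expRN_le2 (k : nat) : expR (- k%:R) <= 2 ^- k :> R.
Proof.
rewrite expRN -[k%:R]mul1r expRM_natr lef_pV2 ?posrE ?exprn_gt0 ?expR_gt0 //.
by rewrite lerXn2r ?nnegrE ?expR_ge0 ?expR1_ge2.
Qed.

(** The value [t = eta / 8] minimises [4 t^2 n^2 - t eta n^2]; the minimum [- eta^2 n^2 / 16] is at
    most [- 4 n]. There are [2 * 4^n] terms, each of mean at most [16^-n]. *)
Lemma cut_bad_mean (eta : R) : 0 < eta -> 64 <= eta ^+ 2 * n%:R ->
  \sum_B weight R p s B * cut_bad (eta / 8) (eta * n%:R ^+ 2) B <= 2 * 2 ^- n.
Proof.
move=> eta0 hn; rewrite /cut_bad; under eq_bigr do rewrite mulr_sumr.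
rewrite exchange_big /=.
apply: (@le_trans _ _ (\sum_(ST : {set 'I_n} * {set 'I_n}) 2 * 2 ^- (4 * n))).
  apply: ler_sum => -[S T] _ /=; under eq_bigr do rewrite mulr_sumr.
  rewrite exchange_big /= big_bool mulrDl mul1r.
  have h (b : bool) : \sum_B weight R p s B * expR (eta / 8 * (\sum_i \sum_j
      ((-1) ^+ b * (i \in S)%:R * (j \in T)%:R) * noise B i j) -
      eta / 8 * (eta * n%:R ^+ 2)) <= 2 ^- (4 * n).
    apply: (@le_trans _ _ (expR (4 * (eta / 8) ^+ 2 * n%:R ^+ 2 -
                                  eta / 8 * (eta * n%:R ^+ 2)))).
      apply: noise_mgf_tilt.
      apply: (@le_trans _ _ (\sum_(i < n) \sum_(j < n) 1)); last first.
        by rewrite !sumr_const !card_ord -[leLHS]mulr_natr expr2.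
      apply: ler_sum => i _; apply: ler_sum => j _.
      by rewrite !exprMn sqrr_sign mul1r -!natrX -natrM; case: (_ \in S); case: (_ \in T).
    apply: le_trans (expRN_le2 _); rewrite ler_expR natrM.
    have : 0 <= n%:R :> R by []; nra.
  by rewrite lerD.
have cardn : #|{: {set 'I_n}}| = (2 ^ n)%N.
  by rewrite -cardsT -powersetT card_powerset cardsT card_ord.
rewrite sumr_const card_prod cardn -[leLHS]mulr_natr natrM.
have a1 : 1 <= (2 : R) ^+ n by rewrite exprn_ege1 // ler1n.
rewrite !natrX -mulrA ler_pM2l // mulnC exprM; set a := _ ^+ n in a1 *.
rewrite (_ : _ * _ = (a ^+ 2)^-1); last by field; lra.
by rewrite lef_pV2 ?posrE; nra.
Qed.

(* Zero has two codes, which only costs a constant factor per entry in the union bound. *)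
Definition sval (N : nat) (x : bool * 'I_N) : R := (-1) ^+ x.1 * x.2%:R.

(** Chernoff terms for the events that an integer vector [x] has correlation above [h |x|^2] with
    the noise applied to [u]. Only [x] with [|x|^2 >= n] are tested, so that the exponent can also
    pay for the number of vectors. *)
Definition vec_bad (u : 'I_n -> R) (t h : R) B : R :=
  \sum_(x : {ffun 'I_n -> bool * 'I_n.+1} | n%:R <= \sum_i sval (x i) ^+ 2)
    expR (t * (\sum_i \sum_j (sval (x i) * u j) * noise B i j)
          - t * (h * \sum_i sval (x i) ^+ 2)).

Lemma vec_bad_ge0 u t h B : 0 <= vec_bad u t h B.
Proof. by apply: sumr_ge0 => ? _; exact: expR_ge0. Qed.

(* The witness [x] is [noise B *m u / h] with entries rounded towards zero; it
   correlates with [noise B *m u] at least as much as [h *: x] does with [x]. *)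
Lemma vec_badP (u : 'I_n -> R) t h B : 0 <= t -> 1 <= h -> (forall j, `|u j| <= 1) ->
  vec_bad u t h B < 1 ->
  \sum_i (\sum_j noise B i j * u j) ^+ 2 <= 4 * h ^+ 2 * n%:R.
Proof.
move=> t0 h1 u1 bad; have h0 : 0 < h by lra.
pose xi i := \sum_j noise B i j * u j.
have xin i : `|xi i| <= n%:R.
  apply: (le_trans (ler_norm_sum _ _ _)).
  apply: (@le_trans _ _ (\sum_(j < n) 1)); last by rewrite sumr_const card_ord.
  by apply: ler_sum => j _; rewrite normrM mulr_ile1 ?noise_max.
pose k i := Num.truncn (`|xi i| / h).
have kh i : (k i)%:R <= `|xi i| / h < (k i).+1%:R.
  by apply: truncn_itv; rewrite divr_ge0 // ltW.
have kn i : (k i < n.+1)%N.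
  rewrite ltnS -(ler_nat R); have /andP[+ _] := kh i; move/le_trans; apply.
  by rewrite ler_pdivrMr //; apply: (le_trans (xin i)); rewrite ler_peMr.
pose x := [ffun i => (xi i < 0, Ordinal (kn i))] : {ffun 'I_n -> bool * 'I_n.+1}.
have xE i : sval (x i) = (-1) ^+ (xi i < 0)%R * (k i)%:R by rewrite /sval ffunE.
have x2 i : sval (x i) ^+ 2 = (k i)%:R ^+ 2 by rewrite xE exprMn sqrr_sign mul1r.
have xx i : h * sval (x i) ^+ 2 <= sval (x i) * xi i.
  have /andP[+ _] := kh i; rewrite ler_pdivlMr // => kx.
  rewrite x2 xE mulrAC -normrEsign expr2 mulrA ler_wpM2r // mulrC //.
(* Otherwise [x] is among the tested vectors and its own term in [vec_bad] is at least 1. *)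
have small : \sum_i sval (x i) ^+ 2 <= n%:R.
  rewrite leNgt; apply/negP => /ltW big; move: bad; rewrite ltNge => /negP; apply.
  rewrite /vec_bad (bigD1 x) //=; apply: (@le_trans _ _ (expR 0)); first by rewrite expR0.
  apply: ler_wpDr; first by apply: sumr_ge0 => ? _; exact: expR_ge0.
  rewrite ler_expR subr_ge0 ler_wpM2l // mulr_sumr; apply: ler_sum => i _.
  apply: (le_trans (xx i)); rewrite /xi mulr_sumr; apply: ler_sum => j _.
  by rewrite -mulrA (mulrC (u j)).
(* Rounding loses less than one unit: [|xi i| <= (k i + 1) h], and [(k + 1)^2 <= 2 (k^2 + 1)]. *)
apply: (@le_trans _ _ (\sum_i (2 * h ^+ 2 * (sval (x i) ^+ 2 + 1)))); last first.
  rewrite -mulr_sumr big_split /= sumr_const card_ord.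
  by have := sqr_ge0 h; nra.
apply: ler_sum => i _; rewrite -/(xi i) x2.
have /andP[_ +] := kh i; rewrite ltr_pdivrMr // -natr1 => xk.
have -> : xi i ^+ 2 = `|xi i| ^+ 2 by rewrite real_normK ?num_real.
apply: (@le_trans _ _ (((k i)%:R + 1) ^+ 2 * h ^+ 2)).
  by rewrite -exprMn lerXn2r ?nnegrE ?mulr_ge0 ?addr_ge0 // ltW.
have := sqr_ge0 ((k i)%:R - 1 : R); have := sqr_ge0 h; nra.
Qed.

Lemma sum_expR_sqr (N : nat) : \sum_(x : bool * 'I_N) expR (- sval x ^+ 2) <= 4.
Proof.
rewrite -(pair_bigA _ (fun b k => expR (- sval (b, k) ^+ 2))) /= big_bool.
have h (b : bool) : \sum_(k < N) expR (- sval (b, k) ^+ 2) <= 2.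
  apply: (@le_trans _ _ (\sum_(k < N) (2^-1) ^+ k)).
    apply: ler_sum => k _; rewrite /sval /= exprMn sqrr_sign mul1r exprVn.
    apply: le_trans (expRN_le2 _); rewrite ler_expR lerN2 -natrX ler_nat.
    by rewrite -mulnn; case: (nat_of_ord k) => // k'; rewrite leq_pmulr.
  have := subrX1 (2^-1 : R) N; have : 0 <= (2^-1 : R) ^+ N by rewrite exprn_ge0.
  by set a := _ ^+ N; set b' := \sum_(_ < _) _ => ? ?; lra.
by apply: (le_trans (lerD (h true) (h false))); lra.
Qed.

(** With this [t] the exponent is [- h^2 q / (16 n) = - 4 q], where [q = |x|^2]. As [q >= n], each
    term is at most [8^-n * expR (- q)], and the sum of [expR (- q)] over all [x] factors over the
    coordinates and is at most [4^n]. *)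
Lemma vec_bad_mean (u : 'I_n -> R) (h : R) : (0 < s)%N -> (forall j, `|u j| <= 1) ->
  h ^+ 2 = 64 * n%:R ->
  \sum_B weight R p s B * vec_bad u (h / (8 * n%:R)) h B <= 2 ^- n.
Proof.
move=> s0 u1 h2; rewrite /vec_bad; under eq_bigr do rewrite mulr_sumr.
have n0 : 0 < n%:R :> R by rewrite ltr0n double_gt0.
rewrite exchange_big /=.
pose q (x : {ffun 'I_n -> bool * 'I_n.+1}) := \sum_i sval (x i) ^+ 2.
apply: (@le_trans _ _ (\sum_(x | n%:R <= q x) 8 ^- n * expR (- q x))).
  apply: ler_sum => x; rewrite -/(q x) => qx.
  apply: (@le_trans _ _ (expR (4 * (h / (8 * n%:R)) ^+ 2 * (n%:R * q x) -
                               h / (8 * n%:R) * (h * q x)))).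
    apply: noise_mgf_tilt; rewrite /q mulr_sumr; apply: ler_sum => i _.
    apply: (@le_trans _ _ (\sum_(j < n) sval (x i) ^+ 2)); last first.
      by rewrite sumr_const card_ord -[leLHS]mulr_natl.
    apply: ler_sum => j _; rewrite exprMn ler_piMr ?sqr_ge0 //.
    by rewrite -real_normK ?num_real // exprn_ile1.
  have -> : 4 * (h / (8 * n%:R)) ^+ 2 * (n%:R * q x) - h / (8 * n%:R) * (h * q x)
          = - 4 * q x.
    rewrite (_ : _ - _ = - (h ^+ 2 / (16 * n%:R) * q x)); last by field; lra.
    by rewrite h2; field; lra.
  apply: (@le_trans _ _ (expR (- (3 * n)%:R) * expR (- q x))).
    by rewrite -expRD ler_expR natrM; lra.
  rewrite ler_wpM2r ?expR_ge0 //; apply: (le_trans (expRN_le2 _)).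
  by rewrite exprM -natrX.
apply: (@le_trans _ _ (\sum_x 8 ^- n * expR (- q x))).
  rewrite [leRHS](bigID (fun x => n%:R <= q x)) /= lerDl.
  by apply: sumr_ge0 => x _; rewrite mulr_ge0 ?expR_ge0 ?invr_ge0 ?exprn_ge0.
rewrite -mulr_sumr.
have -> : \sum_x expR (- q x) = (\sum_(y : bool * 'I_n.+1) expR (- sval y ^+ 2)) ^+ n.
  set S := \sum_(y : bool * _) _.
  have -> : S ^+ n = \prod_(i < n) S by rewrite prodr_const card_ord.
  rewrite bigA_distr_bigA /=.
  by apply: eq_bigr => x _; rewrite /q -sumrN expR_sum.
apply: (@le_trans _ _ (8 ^- n * 4 ^+ n)).
  rewrite ler_wpM2l ?invr_ge0 ?exprn_ge0 // lerXn2r ?nnegrE ?sum_expR_sqr //.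
  by apply: sumr_ge0 => *; exact: expR_ge0.
by rewrite -!exprVn -exprMn lerXn2r ?nnegrE //; lra.
Qed.

Lemma noise_concentration (u : 'I_n -> R) (eta : R) :
  (0 < s)%N -> 0 < eta -> 64 <= eta ^+ 2 * n%:R -> (forall j, `|u j| <= 1) ->
  1 - 3 * 2 ^- n <= Prob R p s (fun B =>
    (forall S T : {set 'I_n},
      `|\sum_i \sum_j (i \in S)%:R * (j \in T)%:R * noise B i j| <= eta * n%:R ^+ 2) /\
    \sum_i (\sum_j noise B i j * u j) ^+ 2 <= 256 * n%:R ^+ 2).
Proof.
move=> s0 eta0 hn u1; have n1 : 1 <= n%:R :> R by rewrite ler1n double_gt0.
pose h := 8 * Num.sqrt (n%:R : R).
have h2 : h ^+ 2 = 64 * n%:R by rewrite exprMn sqr_sqrtr -?natrX //; lra.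
have h1 : 1 <= h.
  have : 1 <= Num.sqrt (n%:R : R) by rewrite -[leLHS]sqrtr1 ler_wsqrtr.
  rewrite /h; lra.
pose f B := cut_bad (eta / 8) (eta * n%:R ^+ 2) B + vec_bad u (h / (8 * n%:R)) h B.
have f1 := cut_bad_mean eta0 hn; have f2 := vec_bad_mean s0 u1 h2.
apply: le_trans (Prob_ge (f := f) _ _); last 2 first.
- by move=> B; rewrite addr_ge0 ?cut_bad_ge0 ?vec_bad_ge0.
- move=> B; have [?|fB] := leP 1 (f B); [by right|left].
  have c0 := cut_bad_ge0 (eta / 8) (eta * n%:R ^+ 2) B.
  have v0 := vec_bad_ge0 u (h / (8 * n%:R)) h B.
  split; first by apply: (cut_badP (t := eta / 8)); rewrite /f in fB; lra.
  have -> : 256 * n%:R ^+ 2 = 4 * h ^+ 2 * n%:R by rewrite h2; ring.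
  apply: (vec_badP (t := h / (8 * n%:R))) => //; last by rewrite /f in fB; lra.
  by rewrite divr_ge0 //; lra.
rewrite lerD2l lerN2 /f; under eq_bigr do rewrite mulrDr.
by rewrite big_split /=; lra.
Qed.

End Concentration.

(** * Inner products and the spectral theorem for real symmetric matrices *)

Section InnerProduct.
Variables (R : rcfType) (n : nat).
Implicit Types (x y z : 'cV[R]_n) (A : 'M[R]_n) (a : R).

Definition dot x y : R := \sum_i x i 0 * y i 0.
Definition vnorm x : R := Num.sqrt (dot x x).
Definition frob A : R := \sum_i \sum_j A i j ^+ 2.

Lemma dotC x y : dot x y = dot y x.
Proof. by apply: eq_bigr => i _; rewrite mulrC. Qed.

Lemma dotDl x y z : dot (x + y) z = dot x z + dot y z.
Proof. by rewrite -big_split; apply: eq_bigr => i _; rewrite mxE mulrDl. Qed.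

Lemma dotZl a x y : dot (a *: x) y = a * dot x y.
Proof. by rewrite mulr_sumr; apply: eq_bigr => i _; rewrite mxE mulrA. Qed.

Lemma dotDr x y z : dot x (y + z) = dot x y + dot x z.
Proof. by rewrite dotC dotDl !(dotC x). Qed.

Lemma dotZr a x y : dot x (a *: y) = a * dot x y.
Proof. by rewrite dotC dotZl dotC. Qed.

Lemma dotNl x y : dot (- x) y = - dot x y.
Proof. by rewrite -scaleN1r dotZl mulN1r. Qed.

Lemma dotNr x y : dot x (- y) = - dot x y.
Proof. by rewrite dotC dotNl dotC. Qed.

Definition dotE := (dotDl, dotDr, dotNl, dotNr, dotZl, dotZr).

Lemma dot_sq x : dot x x = \sum_i x i 0 ^+ 2.
Proof. by apply: eq_bigr => i _; rewrite expr2. Qed.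

Lemma dot_ge0 x : 0 <= dot x x.
Proof. by rewrite dot_sq sumr_ge0 // => i _; exact: sqr_ge0. Qed.

Lemma dot_eq0 x : dot x x = 0 -> x = 0.
Proof.
rewrite dot_sq => /eqP; rewrite psumr_eq0 => [/allP h|i _]; last exact: sqr_ge0.
apply/colP => i; rewrite mxE; apply/eqP.
by have := h i (mem_index_enum i); rewrite /= sqrf_eq0.
Qed.

Lemma dot_CS x y : dot x y ^+ 2 <= dot x x * dot y y.
Proof.
have [y0|y0] := eqVneq (dot y y) 0.
  by rewrite (dot_eq0 y0) -(scale0r 0) !dotE !mul0r expr0n mulr0.
have yp : 0 < dot y y by rewrite lt_def y0 dot_ge0.
have := dot_ge0 (dot y y *: x - dot x y *: y).
rewrite !dotE (dotC y x) => h.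
rewrite -subr_ge0 -(pmulr_rge0 _ yp); apply: le_trans h _; rewrite le_eqVlt.
by apply/orP; left; apply/eqP; ring.
Qed.

Lemma vnorm_ge0 x : 0 <= vnorm x.
Proof. exact: sqrtr_ge0. Qed.

Lemma vnorm_sq x : vnorm x ^+ 2 = dot x x.
Proof. by rewrite sqr_sqrtr ?dot_ge0. Qed.

Lemma norm_dot x y : `|dot x y| <= vnorm x * vnorm y.
Proof.
rewrite -(ler_pXn2r (ltn0Sn 1)) ?nnegrE ?mulr_ge0 ?vnorm_ge0 ?normr_ge0 //.
by rewrite real_normK ?num_real // exprMn !vnorm_sq dot_CS.
Qed.

Lemma vnormD x y : vnorm (x + y) <= vnorm x + vnorm y.
Proof.
rewrite -(ler_pXn2r (ltn0Sn 1)) ?nnegrE ?addr_ge0 ?vnorm_ge0 //.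
rewrite vnorm_sq !dotE (dotC y x) sqrrD !vnorm_sq.
have := ler_norm (dot x y); have := norm_dot x y; lra.
Qed.

Lemma vnormZ a x : vnorm (a *: x) = `|a| * vnorm x.
Proof. by rewrite /vnorm !dotE mulrA -expr2 sqrtrM ?sqr_ge0 // sqrtr_sqr. Qed.

Lemma vnormN x : vnorm (- x) = vnorm x.
Proof. by rewrite -scaleN1r vnormZ normrN1 mul1r. Qed.

Lemma vnormB_ge x y : vnorm x - vnorm y <= vnorm (x - y).
Proof. by rewrite lerBlDr; have := vnormD (x - y) y; rewrite subrK. Qed.

Lemma vnorm_unit x : dot x x = 1 -> vnorm x = 1.
Proof. by rewrite /vnorm => ->; rewrite sqrtr1. Qed.

Lemma dot_mulmx A x y : dot (A *m x) y = dot x (A^T *m y).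
Proof.
rewrite /dot; under eq_bigr do rewrite mxE mulr_suml.
rewrite exchange_big; apply: eq_bigr => j _; rewrite mxE mulr_sumr.
by apply: eq_bigr => i _; rewrite mxE mulrA [_ * A i j]mulrC.
Qed.

Lemma dot_mulmx_sym A x y : A^T = A -> dot (A *m x) y = dot x (A *m y).
Proof. by move=> {2}<-; exact: dot_mulmx. Qed.

Lemma mulmx_col_dot A x i : (A *m x) i 0 = dot (row i A)^T x.
Proof. by rewrite mxE; apply: eq_bigr => j _; rewrite !mxE. Qed.

Lemma frob_rows A : frob A = \sum_i dot (row i A)^T (row i A)^T.
Proof. by apply: eq_bigr => i _; rewrite dot_sq; apply: eq_bigr => j _; rewrite !mxE. Qed.

Lemma bessel2 e f x : dot e e = 1 -> dot f f = 1 -> dot e f = 0 ->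
  dot x e ^+ 2 + dot x f ^+ 2 <= dot x x.
Proof.
move=> ee ff ef; have := dot_ge0 (x - dot x e *: e - dot x f *: f).
rewrite !dotE (dotC f e) (dotC f x) (dotC e x) ee ff ef => h.
by rewrite -subr_ge0; apply: le_trans h _; rewrite le_eqVlt; apply/orP; left; apply/eqP; ring.
Qed.

Lemma bessel3 e f g x : dot e e = 1 -> dot f f = 1 -> dot e f = 0 ->
  dot e g = 0 -> dot f g = 0 ->
  dot x g ^+ 2 <= dot g g * (dot x x - dot x e ^+ 2 - dot x f ^+ 2).
Proof.
move=> ee ff ef eg fg; have := dot_CS (x - dot x e *: e - dot x f *: f) g.
rewrite !dotE (dotC f e) (dotC f x) (dotC e x) ee ff ef eg fg.
rewrite mulrC; set lhs := _ ^+ 2; set rhs := _ * _ => h.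
have -> : dot x g ^+ 2 = lhs by rewrite /lhs; ring.
by apply: le_trans h _; rewrite le_eqVlt; apply/orP; left; apply/eqP; rewrite /rhs; ring.
Qed.

Lemma frob_bessel2 A e f : dot e e = 1 -> dot f f = 1 -> dot e f = 0 ->
  dot (A *m e) (A *m e) + dot (A *m f) (A *m f) <= frob A.
Proof.
move=> ee ff ef; rewrite frob_rows !dot_sq -big_split /=; apply: ler_sum => i _.
by rewrite !mulmx_col_dot; exact: bessel2.
Qed.

(** On the complement of [e] and [f], [A] is bounded by the part of its Frobenius norm that [A *m e]
    and [A *m f] leave over. *)
Lemma frob_bessel3 A e f g : dot e e = 1 -> dot f f = 1 -> dot e f = 0 ->
  dot e g = 0 -> dot f g = 0 ->
  dot (A *m g) (A *m g) <=
  dot g g * (frob A - dot (A *m e) (A *m e) - dot (A *m f) (A *m f)).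
Proof.
move=> ee ff ef eg fg; rewrite frob_rows !(dot_sq (A *m _)) -!sumrB mulr_sumr.
by apply: ler_sum => i _; rewrite !mulmx_col_dot; exact: bessel3.
Qed.

Lemma frob_mulmx A x : dot (A *m x) (A *m x) <= frob A * dot x x.
Proof.
rewrite frob_rows dot_sq mulr_suml; apply: ler_sum => i _.
by rewrite mulmx_col_dot dot_CS.
Qed.

(** Cauchy-Schwarz on [|A x|^2 = <x, A^2 x>]. For the noise, [frob (A *m A)] is [tr E^4], which the
    cut norm controls. *)
Lemma sym_vnorm4 A x : A^T = A -> vnorm (A *m x) ^+ 4 <= frob (A *m A) * vnorm x ^+ 4.
Proof.
move=> As; have h := frob_mulmx (A *m A) x.
rewrite !(exprM _ 2 2) !vnorm_sq dot_mulmx_sym // mulmxA.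
apply: (le_trans (dot_CS _ _)); rewrite [X in _ <= _ * X]expr2 mulrA mulrC.
by rewrite ler_wpM2r ?dot_ge0.
Qed.

End InnerProduct.

Section Spectral.
Variable R : rcfType.

(** The Householder reflection along [q - e] exchanges [e] and [q]; for [q = e] the identity
    serves. *)
Lemma orthogonal_with_row n (q : 'rV[R]_n.+1) : q *m q^T = 1%:M ->
  exists2 H : 'M[R]_n.+1, H *m H^T = 1%:M & row 0 H = q.
Proof.
move=> qq; pose e : 'rV[R]_n.+1 := delta_mx 0 0.
have ee : e *m e^T = 1%:M.
  by rewrite /e trmx_delta mul_delta_mx; apply/matrixP => i j; rewrite !mxE !ord1.
have [qe|qe] := eqVneq q e.
  by exists 1%:M; rewrite ?trmx1 ?mulmx1 // rowE mulmx1.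
pose w := q - e; pose k := (w *m w^T) 0 0.
have ww : w *m w^T = k%:M by rewrite [LHS]mx11_scalar.
pose a := (q *m e^T) 0 0.
have qeT : q *m e^T = a%:M by rewrite [LHS]mx11_scalar.
have eqT : e *m q^T = a%:M by rewrite -(trmxK (e *m q^T)) trmx_mul trmxK qeT tr_scalar_mx.
have kE : k = 2 - 2 * a.
  rewrite /k /w linearB /= mulmxBr !mulmxBl qq ee qeT eqT !mxE eqxx /=; ring.
have k0 : k != 0.
  apply: contra_neq qe => k0; apply/eqP; rewrite -subr_eq0 -/w; apply/eqP.
  apply/trmx_inj; rewrite trmx0; apply: dot_eq0; rewrite -[RHS]k0 /k mxE; apply: eq_bigr => i _.
  by rewrite !mxE.
pose H := 1%:M - (2 / k) *: (w^T *m w); have HT : H^T = H.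
  by rewrite /H linearB linearZ /= trmx1 trmx_mul trmxK.
exists H.
  rewrite HT /H mulmxBr mulmx1 mulmxBl mul1mx -scalemxAl -scalemxAr.
  rewrite -mulmxA (mulmxA w) ww mul_scalar_mx -scalemxAr !scalerA.
  rewrite -addrA -opprD; apply/eqP; rewrite subr_eq addrC -subr_eq subrr eq_sym.
  apply/eqP; rewrite -scalerBl -scalerDl.
  by rewrite (_ : _ + _ = 0) ?scale0r //; field.
rewrite rowE -/e /H mulmxBr mulmx1 -scalemxAr mulmxA.
rewrite (_ : e *m w^T = (a - 1)%:M); last by rewrite /w linearB /= mulmxBr eqT ee raddfB.
rewrite mul_scalar_mx scalerA (_ : 2 / k * (a - 1) = -1).
  by rewrite scaleN1r opprK addrC subrK.
by apply: (mulIf k0); rewrite mulrAC divfK // kE; ring.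
Qed.

Lemma char_poly_orthogonal n (H X : 'M[R]_n) : H *m H^T = 1%:M ->
  char_poly (H *m X *m H^T) = char_poly X.
Proof.
move=> HH; pose f := map_mx (@polyC R) : 'M[R]_n -> 'M[{poly R}]_n.
have ffH : f H *m f H^T = 1%:M by rewrite -map_mxM HH map_mx1.
have -> : char_poly (H *m X *m H^T) = \det (f H *m char_poly_mx X *m f H^T).
  congr (\det _); rewrite /char_poly_mx mulmxBr mulmxBl -!map_mxM.
  by rewrite mul_mx_scalar -scalemxAl ffH scalemx1.
by rewrite !det_mulmx mulrAC -det_mulmx ffH det1 mul1r.
Qed.

(** [sp] may be in any order, and the diagonal follows it. Deflation: a unit left eigenvector for
    the head of [sp] becomes the first row of an orthogonal matrix; conjugating by it makes the
    symmetric matrix block diagonal, and the lower block has the tail as its spectrum. *)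
Theorem sym_spectral n (X : 'M[R]_n) (sp : seq R) : X^T = X ->
  char_poly X = \prod_(x <- sp) ('X - x%:P) ->
  exists2 Q : 'M[R]_n, Q *m Q^T = 1%:M & X = Q^T *m diag_mx (\row_i sp`_i) *m Q.
Proof.
elim: n X sp => [|n IH] X sp Xs cX.
  by exists 1%:M; [apply/matrixP => -[] | apply/matrixP => -[]].
have := size_char_poly X; rewrite cX size_prod_XsubC => -[].
case: sp cX => // x0 sp cX _.
have /eigenvalueP[v vX v0] : eigenvalue X x0.
  by rewrite eigenvalue_root_char cX root_prod_XsubC mem_head.
have vv0 : 0 < dot v^T v^T.
  rewrite lt_def dot_ge0 andbT; apply: contra_neq v0 => /dot_eq0 vT0.
  by rewrite -[v]trmxK vT0 trmx0.
pose q := (vnorm v^T)^-1 *: v.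
have qq : q *m q^T = 1%:M.
  rewrite [LHS]mx11_scalar; congr (_%:M); rewrite /q linearZ /= -scalemxAl -scalemxAr.
  rewrite scalerA mxE -expr2 exprVn vnorm_sq.
  rewrite (_ : (v *m v^T) 0 0 = dot v^T v^T) ?mulVf ?gt_eqF //.
  by rewrite mxE; apply: eq_bigr => i _; rewrite !mxE.
have qX : q *m X = x0 *: q by rewrite /q -scalemxAl vX !scalerA mulrC.
have [H HH Hq] := orthogonal_with_row qq.
have HTH : H^T *m H = 1%:M by exact: mulmx1C.
pose Y := H *m X *m H^T.
have Ys : Y^T = Y by rewrite /Y !trmx_mul trmxK Xs mulmxA.
have Yrow : row 0 Y = x0 *: delta_mx 0 0.
  by rewrite /Y !row_mul Hq qX -scalemxAl -Hq -row_mul HH rowE mulmx1.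
have XE : X = H^T *m Y *m H.
  by rewrite /Y -!mulmxA HTH mulmx1 mulmxA HTH mul1mx.
have cY : char_poly Y = \prod_(x <- x0 :: sp) ('X - x%:P).
  by rewrite char_poly_orthogonal.
clearbody Y; pose Y' := drsubmx (Y : 'M[R]_(1 + n)).
have Y0 j : Y 0 j = x0 * (0 == j)%:R.
  have := congr1 (fun A : 'rV[R]_n.+1 => A 0 j) Yrow; rewrite !mxE => ->.
  by rewrite eqxx eq_sym.
have YE : Y = block_mx (x0%:M : 'M[R]_1) 0 0 Y'.
  have ul : ulsubmx (Y : 'M[R]_(1 + n)) = x0%:M.
    by rewrite [LHS]mx11_scalar !mxE lshift0 Y0 eqxx mulr1.
  have ur : ursubmx (Y : 'M[R]_(1 + n)) = 0.
    by apply/rowP => j; rewrite !mxE lshift0 Y0 mulr0.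
  have dl : dlsubmx (Y : 'M[R]_(1 + n)) = 0.
    by apply/colP => j; rewrite !mxE lshift0 -Ys mxE Y0 mulr0.
  by rewrite -[LHS](@submxK _ 1 n 1 n) ul ur dl.
have Y's : Y'^T = Y' by rewrite /Y' trmx_drsub Ys.
have cY' : char_poly Y' = \prod_(x <- sp) ('X - x%:P).
  have dY : char_poly Y = \det (block_mx (char_poly_mx (x0%:M : 'M[R]_1)) 0 0 (char_poly_mx Y')).
    by rewrite -char_block_diag_mx -YE.
  move: cY; rewrite dY det_ublock big_cons.
  rewrite (_ : \det (char_poly_mx x0%:M) = 'X - x0%:P).
    by apply: mulfI; rewrite polyXsubC_eq0.
  by rewrite det_mx11 !mxE eqxx.
have [Q' QQ' Y'E] := IH _ _ Y's cY'.
pose P : 'M[R]_(1 + n) := block_mx 1%:M 0 0 Q'.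
pose D : 'M[R]_(1 + n) := diag_mx (\row_i (x0 :: sp)`_i).
have PP : P *m P^T = 1%:M.
  rewrite tr_block_mx mulmx_block !(trmx0, trmx1, mul0mx, mulmx0, mulmx1, addr0, add0r).
  by rewrite QQ' -scalar_mx_block.
have DE : D = block_mx (x0%:M : 'M[R]_1) 0 0 (diag_mx (\row_i sp`_i)).
  have -> : D = diag_mx (row_mx (x0%:M : 'rV[R]_1) (\row_i sp`_i)).
    congr diag_mx; apply/rowP => i; rewrite !mxE.
    by case: splitP => j ->; rewrite !mxE // ord1 eqxx.
  rewrite diag_mx_row; congr (block_mx _ 0 0 _); apply/matrixP => i j.
  by rewrite !mxE !ord1 eqxx.
have PDP : P^T *m D *m P = Y.
  rewrite YE DE tr_block_mx !mulmx_block.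
  by rewrite !(trmx0, trmx1, mul0mx, mulmx0, mul1mx, mulmx1, addr0, add0r) Y'E.
clearbody P; exists (P *m H).
  by rewrite trmx_mul mulmxA -(mulmxA P) HH mulmx1.
by rewrite trmx_mul [LHS]XE -PDP !mulmxA.
Qed.

End Spectral.

(** * The model matrix and its trigonometric eigenvector *)

Section Trigonometry.
Variable R : realType.
Implicit Types (x a b : R).

(** Each Taylor bound on sine and cosine below follows from the previous one by this. *)
Lemma is_derive_ge0_le (f df : R -> R) x : (forall y : R, is_derive y 1 f (df y)) ->
  (forall y, 0 <= y -> 0 <= df y) -> 0 <= x -> f 0 <= f x.
Proof.
move=> fdf df0 x0; have [|c] := @MVT_segment R f df 0 x x0 (fun y _ => fdf y).
  apply: continuous_subspaceT => y; apply: differentiable_continuous.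
  by apply/derivable1_diffP; exact: ex_derive.
rewrite in_itv /= => /andP[c0 _] fx.
by rewrite -subr_ge0 fx subr0 mulr_ge0 // df0.
Qed.

Lemma sin_lex x : 0 <= x -> sin x <= x.
Proof.
move=> x0; rewrite -subr_ge0.
have := @is_derive_ge0_le (id - sin) (fun y => 1 - cos y) x _ _ x0.
by rewrite !fctE sin0 subr0; apply=> y *; rewrite ?subr_ge0 ?cos_le1.
Qed.

Lemma cos_ge_poly x : 0 <= x -> 1 - x ^+ 2 / 2 <= cos x.
Proof.
move=> x0; have := @is_derive_ge0_le (cos + 2^-1 *: (id ^+ 2)) (fun y => y - sin y) x _ _ x0.
rewrite !fctE /= cos0 expr0n scaler0 => h; have : 1 + 0 <= cos x + 2^-1 *: (x ^+ 2).
  apply: h => y; last by move=> y0; rewrite subr_ge0 sin_lex.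
  apply: is_derive_eq; by rewrite /GRing.scale /=; field.
by rewrite /GRing.scale /=; lra.
Qed.

Lemma sin_ge_poly x : 0 <= x -> x - x ^+ 3 / 6 <= sin x.
Proof.
move=> x0; have := @is_derive_ge0_le (sin - id + 6^-1 *: (id ^+ 3))
  (fun y => cos y - (1 - y ^+ 2 / 2)) x _ _ x0.
rewrite !fctE /= sin0 expr0n scaler0 => h.
have : 0 - 0 + 0 <= sin x - x + 6^-1 *: (x ^+ 3).
  apply: h => y; last by move=> y0; rewrite subr_ge0 cos_ge_poly.
  apply: is_derive_eq; by rewrite /GRing.scale /=; field.
by rewrite /GRing.scale /=; lra.
Qed.

Lemma cos_le_poly x : 0 <= x -> cos x <= 1 - x ^+ 2 / 2 + x ^+ 4 / 24.
Proof.
move=> x0; have := @is_derive_ge0_le (24^-1 *: (id ^+ 4) - 2^-1 *: (id ^+ 2) - cos)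
  (fun y => sin y - (y - y ^+ 3 / 6)) x _ _ x0.
rewrite !fctE /= cos0 !expr0n !scaler0 => h.
have : 0 - 0 - 1 <= 24^-1 *: (x ^+ 4) - 2^-1 *: (x ^+ 2) - cos x.
  apply: h => y; last by move=> y0; rewrite subr_ge0 sin_ge_poly.
  apply: is_derive_eq; by rewrite /GRing.scale /=; field.
by rewrite /GRing.scale /=; lra.
Qed.

(** Otherwise [8 / 5] lies in the first quadrant, but the quartic bound on the cosine is negative
    there. *)
Lemma pi_lt32 : pi < 16 / 5 :> R.
Proof.
rewrite ltNge; apply/negP => h; have := @cos_le_poly (8 / 5) ltac:(lra).
have := @cos_ge0_pihalf R (8 / 5); rewrite (_ : _ && _); last by apply/andP; split; lra.
by move=> /(_ isT); lra.
Qed.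

Lemma sin_ge_half x : 0 <= x <= pi / 2 -> x / 2 <= sin x.
Proof.
move=> /andP[x0 x1]; have := sin_ge_poly x0; have := pi_lt32 => ? h.
have x8 : x <= 8 / 5 by lra.
apply: le_trans h; have : x ^+ 2 <= 64 / 25 by nra.
nra.
Qed.

(** The bound is only quadratic because the cosine is flat at 0 and [pi]. In [cos a - cos b = 2 sin
    ((b - a) / 2) sin ((a + b) / 2)] the last factor is [sin ((b - a) / 2) + 2 cos (b / 2) sin (a /
    2)], whose second summand is nonnegative. *)
Lemma cosB_ge a b : 0 <= a -> a <= b -> b <= pi -> (b - a) ^+ 2 / 8 <= cos a - cos b.
Proof.
move=> a0 ab bpi; have : cos a - cos b = 2 * sin ((b - a) / 2) ^+ 2 +
    4 * sin ((b - a) / 2) * cos (b / 2) * sin (a / 2).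
  have hb := cos2Dsin2 (b / 2); have ha := cos2Dsin2 (a / 2).
  have -> : cos a = 2 * cos (a / 2) ^+ 2 - 1.
    by rewrite {1}(_ : a = (a / 2) *+ 2) ?cos_mulr2n; ring || (rewrite mulr2n; lra).
  have -> : cos b = 2 * cos (b / 2) ^+ 2 - 1.
    by rewrite {1}(_ : b = (b / 2) *+ 2) ?cos_mulr2n; ring || (rewrite mulr2n; lra).
  rewrite mulrBl sinB.
  move: hb ha; set ca := cos (a / 2); set sa := sin (a / 2);
  set cb := cos (b / 2); set sb := sin (b / 2).
  move=> hb ha.
  have : ca ^+ 2 = 1 - sa ^+ 2 by lra.
  have : cb ^+ 2 = 1 - sb ^+ 2 by lra.
  move=> cb2 ca2.
  have -> : 2 * (sb * ca - cb * sa) ^+ 2 + 4 * (sb * ca - cb * sa) * cb * sa =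
            2 * (sb ^+ 2 * ca ^+ 2) - 2 * (cb ^+ 2 * sa ^+ 2) by ring.
  by rewrite ca2 cb2; ring.
have h0 : 0 <= (b - a) / 2 <= pi / 2 by apply/andP; split; lra.
have := sin_ge_half h0; have := @cos_ge0_pihalf R (b / 2).
have pi0 := pi_ge0 R.
rewrite (_ : _ && _); last by apply/andP; split; lra.
have := @sin_ge0_pi R (a / 2); rewrite (_ : _ && _); last by apply/andP; split; lra.
move=> /(_ isT) sa /(_ isT) cb sh ->.
have sh0 : 0 <= sin ((b - a) / 2) by move/andP: h0 => [? _]; lra.
have : 0 <= 4 * sin ((b - a) / 2) * cos (b / 2) * sin (a / 2) by rewrite !mulr_ge0.
move: sh; set S := sin _ => sh ?.
have : ((b - a) / 2 / 2) ^+ 2 <= S ^+ 2.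
  by rewrite lerXn2r ?nnegrE //; move/andP: h0 => [? _]; lra.
nra.
Qed.

End Trigonometry.

(** * Eigenpair, total mass and Frobenius norm of the model matrix *)

Section Model.
Variables (R : realType) (s : nat).
Hypothesis s_gt0 : (0 < s)%N.
Local Notation n := (s.*2).

Lemma natr_double : n%:R = 2 * s%:R :> R.
Proof. by rewrite -muln2 natrM mulrC. Qed.

Definition theta : R := pi / (4 * s + 2)%N%:R.

(* The middle of the cosine profile skips one step: [u_j = cos ((2j-1) theta)] for
   [j <= s], but [u_j = cos ((2j+1) theta)] for [j > s]. *)
Definition uangle (i : nat) : R :=
  (if (i < s)%N then 2 * i%:R + 1 else 2 * i%:R + 3) * theta.

Lemma theta_sum : (4 * s%:R + 2) * theta = pi.
Proof.
by rewrite /theta -natrM -natrD mulrC divfK.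
Qed.

Lemma theta_gt0 : 0 < theta.
Proof. by rewrite divr_gt0 ?pi_gt0 // ltr0n addnC. Qed.

Lemma uvec_cos (i : 'I_n) : uvec R s i 0 = cos (uangle i).
Proof.
have pE := theta_sum.
rewrite mxE /uangle; case: ifP => [_|/negbT]; first by rewrite natrD natrM -mulrA.
rewrite -leqNgt => si; rewrite -cosDpi -/theta; have li := ltn_ord i.
rewrite -mulrA -/theta -cosN -[LHS]cosD2pi; congr cos.
have -> : (2 * (n - 1 - i) + 1)%N%:R = 4 * s%:R - 1 - 2 * i%:R :> R.
  rewrite natrD natrM -subnDA natrB; last by lia.
  by rewrite natrD natr_double; ring.
by rewrite mulr2n -pE; ring.
Qed.

Lemma uangle_ge0 i : 0 <= uangle i.
Proof. by rewrite mulr_ge0 ?(ltW theta_gt0) //; case: ifP => _; rewrite addr_ge0 ?mulr_ge0. Qed.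

Lemma uangle_lepi i : (i < n)%N -> uangle i <= pi.
Proof.
move=> ni; rewrite -theta_sum ler_wpM2r ?(ltW theta_gt0) //.
have : (i.+1)%:R <= n%:R :> R by rewrite ler_nat.
rewrite -natr1 -muln2 natrM; case: ifP => [|] _; lra.
Qed.

Lemma uangle_diff i j : (i <= j)%N -> 2 * (j - i)%:R * theta <= uangle j - uangle i.
Proof.
move=> ij; rewrite natrB // -mulrBl ler_wpM2r ?(ltW theta_gt0) //.
case: ifP => js; case: ifP => is_ //; try lra.
by move: (leq_ltn_trans ij js); rewrite is_.
Qed.

Lemma uvec_gap (i j : 'I_n) : (i <= j)%N ->
  (j - i)%:R ^+ 2 / (5 * n%:R ^+ 2) <= uvec R s i 0 - uvec R s j 0.
Proof.
move=> ij; rewrite !uvec_cos.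
have d0 := uangle_diff ij; have t0 := theta_gt0.
have dd0 : 0 <= 2 * (j - i)%:R * theta by rewrite mulr_ge0 ?(ltW t0) // mulr_ge0.
have d1 : uangle i <= uangle j by rewrite -subr_ge0 (le_trans dd0).
apply: le_trans (cosB_ge (uangle_ge0 i) d1 (uangle_lepi (ltn_ord j))).
apply: (@le_trans _ _ ((2 * (j - i)%:R * theta) ^+ 2 / 8)); last first.
  by rewrite ler_pM2r // lerXn2r ?nnegrE ?subr_ge0.
have n2 : 2 <= n%:R :> R by rewrite (ler_nat R 2) -[2%N]/(1.*2) leq_double.
(* Since [(2 n + 2) theta = pi >= 2], this is at least [n / (n + 1)], and [n >= 2]. *)
have tn : 2 / 3 <= n%:R * theta.
  have := theta_sum; have := pi_ge2 R; rewrite (_ : 4 * s%:R = 2 * n%:R :> R).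
    nra.
  by rewrite -muln2 natrM; ring.
rewrite ler_pdivrMr; last by rewrite mulr_gt0 // exprn_gt0 //; lra.
have -> : (2 * (j - i)%:R * theta) ^+ 2 / 8 * (5 * n%:R ^+ 2) =
          (j - i)%:R ^+ 2 * (5 / 2 * (n%:R * theta) ^+ 2) by field.
by rewrite ler_peMr ?sqr_ge0 //; nra.
Qed.

Lemma big_ord_half (f : nat -> R) :
  \sum_(i < n) f i = \sum_(i < s) (f i + f (s + i)%N).
Proof. by rewrite -addnn big_split_ord big_split. Qed.

Lemma big_ord_ltn (f : nat -> R) k : (k <= n)%N ->
  \sum_(j < n) (if (j < k)%N then f j else 0) = \sum_(j < k) f j.
Proof. by move=> kn; rewrite -big_mkcond -(big_ord_widen n f kn). Qed.

(** The window around [i] is an initial segment of columns in the upper half of the rows and the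
    complement of one in the lower half, so partial sums suffice. *)
Lemma band_sum (f : nat -> R) i : (i < n)%N ->
  \sum_(j < n) (if (ndist i j < s)%N then f j else 0) =
  if (i < s)%N then \sum_(j < i + s) f j
  else \sum_(j < n) f j - \sum_(j < (i - s).+1) f j.
Proof.
move=> ni; case: ifP => is_.
  rewrite -big_ord_ltn; last by lia.
  apply: eq_bigr => j _; rewrite (_ : (ndist i j < s)%N = (j < i + s)%N) //.
  by rewrite /ndist; have := ltn_ord j; lia.
rewrite -[X in _ - X]big_ord_ltn; last by lia.
rewrite -sumrB; apply: eq_bigr => j _.
rewrite (_ : (ndist i j < s)%N = ~~ (j < (i - s).+1)%N); last first.
  by rewrite /ndist; have := ltn_ord j; lia.
by case: (_ < _)%N => /=; rewrite ?subrr ?subr0.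
Qed.

(** With the diagonal filled in, every row is supported on an interval; the correction shifts
    eigenvalues by [p] only. *)
Lemma Mmodel_band p (i j : 'I_n) :
  Mmodel R p s i j = (if (ndist i j < s)%N then p else 0) - (if i == j then p else 0).
Proof.
rewrite mxE -val_eqE /=; case: (eqVneq (i : nat) j) => [->|ij].
  by rewrite /ndist subnn /= s_gt0 subrr.
rewrite subr0; congr (if _ then _ else _); rewrite /ndist; move/eqP: ij; lia.
Qed.

Lemma Mmodel_row p (f : nat -> R) (i : 'I_n) :
  \sum_j Mmodel R p s i j * f j =
  p * (\sum_(j < n) (if (ndist i j < s)%N then f j else 0) - f i).
Proof.
under eq_bigr do rewrite Mmodel_band mulrBl.
rewrite sumrB mulrBr mulr_sumr; congr (_ - _).
  by apply: eq_bigr => j _; case: ifP => _; rewrite ?mul0r ?mulr0.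
rewrite (bigD1 i) //= eqxx big1 ?addr0 // => j ji.
by rewrite eq_sym (negbTE ji) mul0r.
Qed.

(** Rows [i] and [s + i] together have [3 (s - 1)] nonzero positions, whatever [i] is. *)
Lemma Mmodel_total p : \sum_i \sum_j Mmodel R p s i j = 3 * p * s%:R * (s%:R - 1).
Proof.
pose g (i : nat) : R := p * ((if (i < s)%N then (i + s)%:R else n%:R - (i - s).+1%:R) - 1).
have -> : \sum_i \sum_j Mmodel R p s i j = \sum_(i < n) g i.
  apply: eq_bigr => i _; have := Mmodel_row p (fun=> 1) i.
  under eq_bigr do rewrite mulr1; move=> ->.
  by rewrite (band_sum (fun=> 1)) // !sumr_const !card_ord /g.
rewrite big_ord_half (eq_bigr (fun=> 3 * p * (s%:R - 1))).
  by rewrite sumr_const card_ord -mulr_natr; ring.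
move=> i _; rewrite /g ltn_ord ltnNge leq_addr /= addKn natrD -natr1 -muln2 natrM.
ring.
Qed.

Lemma Mmodel_frob p : frob (Mmodel R p s) = 3 * p ^+ 2 * s%:R * (s%:R - 1).
Proof.
have -> : frob (Mmodel R p s) = p * \sum_i \sum_j Mmodel R p s i j.
  rewrite mulr_sumr; apply: eq_bigr => i _; rewrite mulr_sumr; apply: eq_bigr => j _.
  by rewrite mxE; case: ifP => _; rewrite ?mulr0 ?expr0n // expr2.
by rewrite Mmodel_total; ring.
Qed.

(* [2 * sin theta] times the partial sum of the first [k] entries of [u]; both
   branches agree at [k = s]. *)
Definition upot (k : nat) : R :=
  sin ((if (k <= s)%N then 2 * k%:R else 2 * k%:R + 2) * theta).

Lemma sin_pi_sub (x y : R) : x + y = pi -> sin x = sin y.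
Proof. by move=> xy; rewrite (_ : y = - x + pi) ?sinDpi ?sinN ?opprK //; lra. Qed.

Lemma upot_ge k : (s <= k)%N -> upot k = sin ((2 * k%:R + 2) * theta).
Proof.
rewrite leq_eqVlt => /orP[/eqP<-|sk]; last by rewrite /upot leqNgt sk.
by rewrite /upot leqnn; apply: sin_pi_sub; rewrite -theta_sum; ring.
Qed.

Lemma cos_telescope (x : R) :
  2 * sin theta * cos x = sin (x + theta) - sin (x - theta).
Proof. by rewrite sinD sinB; ring. Qed.

Lemma upot_sum k : 2 * sin theta * \sum_(j < k) cos (uangle j) = upot k.
Proof.
elim: k => [|k IH]; first by rewrite big_ord0 mulr0 /upot /= mulr0 mul0r sin0.
rewrite big_ord_recr mulrDr IH cos_telescope /uangle.
case: (ltnP k s) => ks.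
  rewrite /upot ltnW // ks -natr1.
  rewrite (_ : (2 * k%:R + 1) * theta - theta = 2 * k%:R * theta); last by ring.
  by rewrite addrC subrK; congr sin; ring.
rewrite upot_ge // upot_ge ?leqW // -natr1.
rewrite (_ : (2 * k%:R + 3) * theta - theta = (2 * k%:R + 2) * theta); last by ring.
by rewrite addrC subrK; congr sin; ring.
Qed.

(** Since [(2 s + 1) theta = pi / 2], the partial sum that [band_sum] selects is the sine of
    [uangle i] shifted by a quarter turn. In the lower half the full sum vanishes, being
    [sin pi]. *)
Lemma u_band (i : nat) : (i < n)%N ->
  2 * sin theta * \sum_(j < n) (if (ndist i j < s)%N then cos (uangle j) else 0) =
  cos (uangle i).
Proof.
move=> ni; have tp := theta_sum; rewrite (band_sum (fun j => cos (uangle j))) // /uangle.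
case: ifP => is_.
  rewrite (upot_sum (i + s)) upot_ge ?leq_addl // -sinDpihalf natrD; congr sin.
  by rewrite -tp; field.
rewrite mulrBr !upot_sum upot_ge; last by rewrite -addnn leq_addr.
have -> : (2 * n%:R + 2) * theta = pi by rewrite -tp -muln2 natrM; ring.
rewrite sinpi sub0r /upot (_ : ((i - s).+1 <= s)%N = true); last by lia.
rewrite -[RHS]opprK -sinBpihalf; congr (- sin _).
have -> : (i - s).+1%:R = i%:R - s%:R + 1 :> R.
  by rewrite -addn1 natrD natrB // leqNgt is_.
by rewrite -tp; field.
Qed.

Lemma sin_theta_gt0 : 0 < sin theta.
Proof.
apply: sin_gt0_pi; rewrite theta_gt0 -theta_sum /=; have := theta_gt0.
have s1 : 1 <= s%:R :> R by rewrite ler1n.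
nra.
Qed.

Definition ulambda p : R := p / (2 * sin theta) - p.

Lemma Mmodel_u p : Mmodel R p s *m uvec R s = ulambda p *: uvec R s.
Proof.
have st := sin_theta_gt0.
apply/colP => i; rewrite mxE.
under eq_bigr do rewrite uvec_cos.
rewrite (Mmodel_row p (fun j => cos (uangle j))) [RHS]mxE uvec_cos.
rewrite -[in X in _ = _ * X](u_band (ltn_ord i)) -[X in _ - X](u_band (ltn_ord i)) /ulambda.
set S := \sum_(_ < _) _; field.
by rewrite gt_eqF.
Qed.

(** From [sin theta <= theta] and [pi < 16 / 5]: [1 / (2 theta) = (2 s + 1) / pi >= 5 s / 8]. *)
Lemma ulambda_ge p : 0 <= p -> p * (5 / 8 * s%:R - 1) <= ulambda p.
Proof.
move=> p0; rewrite /ulambda -[p in X in _ <= _ - X]mulr1 -mulrBr ler_wpM2l // lerD2r.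
have st := sin_theta_gt0; rewrite -[leRHS]div1r ler_pdivlMr; last by lra.
have := sin_lex (ltW theta_gt0); have := theta_sum; have := pi_lt32 R.
have : 1 <= s%:R :> R by rewrite ler1n.
have := theta_gt0; set t := theta; set st' := sin _ => *.
have : s%:R * st' <= s%:R * t by rewrite ler_wpM2l.
lra.
Qed.

Lemma u_norm_max (i : 'I_n) : `|uvec R s i 0| <= 1.
Proof. by rewrite uvec_cos cos_max. Qed.

Lemma dot_u_le : dot (uvec R s) (uvec R s) <= n%:R.
Proof.
rewrite dot_sq; apply: (@le_trans _ _ (\sum_(i < n) 1)); last first.
  by rewrite sumr_const card_ord.
by apply: ler_sum => i _; rewrite -real_normK ?num_real // exprn_ile1 ?u_norm_max.
Qed.

(** The entries [i] and [s + i] together contribute at least 1: their angles differ by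
    [pi / 2 + theta], and without the extra [theta] the squares would add up to exactly 1. *)
Lemma dot_u_ge : s%:R <= dot (uvec R s) (uvec R s).
Proof.
have tp := theta_sum; have t0 := theta_gt0.
rewrite dot_sq; under eq_bigr do rewrite uvec_cos.
rewrite (big_ord_half (fun i => cos (uangle i) ^+ 2)).
apply: (@le_trans _ _ (\sum_(i < s) 1)); first by rewrite sumr_const card_ord.
apply: ler_sum => i _; rewrite /uangle ltn_ord ltnNge leq_addr /=.
have -> : (2 * (s + i)%:R + 3) * theta = (2 * i%:R + 2) * theta + pi / 2.
  by rewrite natrD -tp; field.
rewrite cosDpihalf sqrrN -[leLHS](cos2Dsin2 ((2 * i%:R + 2) * theta)) lerD2r.
have si : (i.+1)%:R <= s%:R :> R by rewrite ler_nat.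
rewrite -natr1 in si; have i0 : 0 <= i%:R :> R by [].
have a1 : (2 * i%:R + 2) * theta <= pi / 2 by nra.
have a0 : 0 <= (2 * i%:R + 1) * theta by rewrite mulr_ge0 //; lra.
have a2 : (2 * i%:R + 1) * theta <= (2 * i%:R + 2) * theta by nra.
rewrite lerXn2r ?nnegrE ?cos_ge0_pihalf //; [apply/andP; split; lra..|].
have := cosB_ge a0 a2; have := pi_ge0 R => pi0 /(_ ltac:(lra)).
by have := sqr_ge0 ((2 * i%:R + 2) * theta - (2 * i%:R + 1) * theta); lra.
Qed.

(** Makes the constant vector orthogonal to [u], as the perturbation argument requires. *)
Lemma sum_u : \sum_i uvec R s i 0 = 0.
Proof.
have st := sin_theta_gt0; under eq_bigr do rewrite uvec_cos.
apply: (mulfI (x := 2 * sin theta)); first by rewrite mulf_neq0 // gt_eqF.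
rewrite upot_sum mulr0 upot_ge; last by rewrite -addnn leq_addr.
have -> : (2 * n%:R + 2) * theta = pi by rewrite -theta_sum -muln2 natrM; ring.
exact: sinpi.
Qed.

End Model.

(** * Perturbation of the second eigenvector *)

Section Perturbation.
Variables (R : rcfType) (n : nat).
Implicit Types (x y w : 'cV[R]_n).

Lemma sym_eigenbasis (X : 'M[R]_n) (sp : seq R) : X^T = X ->
  char_poly X = \prod_(x <- sp) ('X - x%:P) ->
  exists q : 'I_n -> 'cV[R]_n, [/\ forall i j, dot (q i) (q j) = (i == j)%:R,
    forall x, dot x x = \sum_i dot (q i) x ^+ 2 & forall i, X *m q i = sp`_i *: q i].
Proof.
move=> Xs cX; have [Q QQ XE] := sym_spectral Xs cX.
have QTQ : Q^T *m Q = 1%:M by exact: mulmx1C.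
have qE i : (row i Q)^T = Q^T *m delta_mx i 0 by rewrite tr_row colE.
exists (fun i => (row i Q)^T); split.
- move=> i j; have := congr1 (fun A : 'M[R]_n => A i j) QQ; rewrite !mxE => <-.
  by apply: eq_bigr => k _; rewrite !mxE.
- move=> x; under eq_bigr do rewrite -mulmx_col_dot.
  by rewrite -dot_sq dot_mulmx mulmxA QTQ mul1mx.
- move=> i; rewrite qE {1}XE -!mulmxA (mulmxA Q) QQ mul1mx scalemxAr; congr (_ *m _).
  apply/colP => k; rewrite mul_diag_mx !mxE.
  by case: eqP => [->|_]; rewrite ?mulr0.
Qed.

(** In the application [K] is [p * s] and [o] is the normalised constant vector. The single small
    quantity [d] bounds both the operator norm of the noise and the lower-order errors in the
    eigenvalue and the Rayleigh quotient. *)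
Variables (M X : 'M[R]_n) (K d l : R) (u o : 'cV[R]_n).
Local Notation E := (X - M).
Hypotheses (M_sym : M^T = M) (X_sym : X^T = X) (d_gt0 : 0 < d) (d_le : 32 * (40 * d) <= K).
Hypotheses (u_unit : dot u u = 1) (o_unit : dot o o = 1) (u_orth_o : dot u o = 0).
Hypotheses (Mu : M *m u = l *: u) (l_ge : 5 / 8 * K - d <= l).
Hypotheses (M_frob : frob M <= 3 * K ^+ 2) (Mo : 3 / 2 * K - d <= dot o (M *m o)).
Hypothesis E_small : forall x, vnorm (E *m x) <= d * vnorm x.

Lemma vnorm_M_ge x : vnorm (X *m x) - d * vnorm x <= vnorm (M *m x).
Proof.
have -> : M *m x = X *m x - E *m x by rewrite -mulmxBl opprB addrC subrK.
by apply: le_trans (vnormB_ge _ _); rewrite lerD2l lerN2.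
Qed.

Lemma vnorm_X_ge x : vnorm (M *m x) - d * vnorm x <= vnorm (X *m x).
Proof.
have -> : X *m x = M *m x - - (E *m x) by rewrite opprK -mulmxDl addrC subrK.
by apply: le_trans (vnormB_ge _ _); rewrite vnormN lerD2l lerN2.
Qed.

Lemma vnorm_Mo_ge : 3 / 2 * K - d <= vnorm (M *m o).
Proof.
apply: le_trans Mo _; apply: le_trans (ler_norm _) _.
by apply: le_trans (norm_dot _ _) _; rewrite vnorm_unit // mul1r.
Qed.

Section Eigenvalues.
Variable sp : seq R.
Hypotheses (sp_char : char_poly X = \prod_(x <- sp) ('X - x%:P))
           (sp_sorted : sorted (fun a b : R => `|b| <= `|a|) sp) (n_gt1 : (1 < n)%N).

Lemma size_spectrum : size sp = n.
Proof. by have := size_char_poly X; rewrite sp_char size_prod_XsubC => -[]. Qed.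

Lemma spectrum_decr i j : (i <= j < n)%N -> `|sp`_j| <= `|sp`_i|.
Proof.
move=> /andP[ij jn].
apply: (sorted_leq_nth (leT := fun a b : R => `|b| <= `|a|)) => //.
- by move=> a b c ab bc; exact: le_trans bc ab.
- by rewrite inE size_spectrum (leq_ltn_trans ij).
- by rewrite inE size_spectrum.
Qed.

(* Two orthonormal eigenvectors of [X] cannot both have an eigenvalue larger than the
   Frobenius norm of [M] permits. *)
Lemma lambda2_le : `|sp`_1| <= 5 / 4 * K.
Proof.
have d0 := d_gt0; have dK := d_le.
have [q [qq _ Xq]] := sym_eigenbasis X_sym sp_char.
pose i0 := Ordinal (ltnW n_gt1); pose i1 := Ordinal n_gt1.
have h (i : 'I_n) : (i <= 1)%N -> `|sp`_1| - d <= vnorm (M *m q i).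
  move=> i1'; apply: le_trans (vnorm_M_ge _).
  by rewrite Xq vnormZ vnorm_unit ?qq ?eqxx // !mulr1 lerD2r spectrum_decr // i1'.
have := frob_bessel2 M (e := q i0) (f := q i1); rewrite !qq !eqxx /= -!vnorm_sq.
move=> /(_ erefl erefl erefl) hf; have := h i0 isT; have := h i1 isT.
move=> h1 h0; rewrite leNgt; apply/negP => big.
move: big h0 h1 hf; set c := `|_|.
set a := vnorm (M *m q i0); set b := vnorm (M *m q i1) => big h0 h1 hf.
(* The factor 31/25 is below 5/4 by more than [d / K], yet [2 * (31 / 25)^2 > 3] contradicts
   [M_frob]. *)
have : (31 / 25 * K) ^+ 2 <= a ^+ 2 by apply: lerXn2r; rewrite ?nnegrE; lra.
have : (31 / 25 * K) ^+ 2 <= b ^+ 2 by apply: lerXn2r; rewrite ?nnegrE; lra.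
by move: M_frob; nra.
Qed.

(* On the plane spanned by [u] and [o] both [M] and [X] expand; some vector of this
   plane is orthogonal to the first eigenvector of [X]. *)
Lemma lambda2_ge : 5 / 8 * K - 2 * d <= `|sp`_1|.
Proof.
have d0 := d_gt0; have dK := d_le; have l0 := l_ge.
have [q [qq parseval Xq]] := sym_eigenbasis X_sym sp_char.
pose i0 := Ordinal (ltnW n_gt1).
have [a [b [ab ab0]]] : exists a b, 0 < a ^+ 2 + b ^+ 2 /\
    a * dot (q i0) o + b * dot (q i0) u = 0.
  have [z|nz] := eqVneq (dot (q i0) o) 0.
    by exists 1, 0; rewrite z; split; lra.
  exists (dot (q i0) u), (- dot (q i0) o); split; last by ring.
  by rewrite sqrrN ltr_wpDl ?sqr_ge0 // exprn_even_gt0.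
pose x := a *: o + b *: u.
have xx : dot x x = a ^+ 2 + b ^+ 2.
  by rewrite /x !dotE (dotC o) u_unit o_unit u_orth_o; ring.
have qx : dot (q i0) x = 0 by rewrite /x !dotE.
(* The images of [o] and [u] under [M] are orthogonal because [u] is an eigenvector, so their
   squared norms add up. *)
have MM : (5 / 8 * K - d) ^+ 2 * dot x x <= dot (M *m x) (M *m x).
  have -> : dot (M *m x) (M *m x) = a ^+ 2 * vnorm (M *m o) ^+ 2 + b ^+ 2 * l ^+ 2.
    rewrite vnorm_sq /x mulmxDr -!scalemxAr Mu !dotE (dotC u (M *m o)) dot_mulmx_sym //.
    by rewrite Mu !dotE (dotC o) u_unit u_orth_o; ring.
  have Mo1 := vnorm_Mo_ge; rewrite xx mulrDr.
  by apply: lerD; rewrite mulrC; apply: ler_wpM2l; rewrite ?sqr_ge0 //;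
    apply: lerXn2r; rewrite ?nnegrE; lra.
clearbody x.
(* In the eigenbasis [x] has no component along [q i0], the only vector whose eigenvalue may exceed
   the second. *)
have XX : dot (X *m x) (X *m x) <= `|sp`_1| ^+ 2 * dot x x.
  rewrite !parseval mulr_sumr; apply: ler_sum => i _.
  rewrite -dot_mulmx_sym // Xq !dotE exprMn.
  case: (posnP i) => [iz|ip]; last first.
    rewrite ler_wpM2r ?sqr_ge0 // -real_normK ?num_real // lerXn2r ?nnegrE //.
    by rewrite spectrum_decr // ip /=.
  have -> : i = i0 by exact/val_inj.
  by rewrite qx expr0n !mulr0.
have xp : 0 < vnorm x by rewrite sqrtr_gt0 xx.
have M1 : (5 / 8 * K - d) * vnorm x <= vnorm (M *m x).
  rewrite -(ler_pXn2r (ltn0Sn 1)) ?nnegrE ?mulr_ge0 ?vnorm_ge0 //; last by lra.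
  by rewrite exprMn !vnorm_sq.
have X1 : vnorm (X *m x) <= `|sp`_1| * vnorm x.
  rewrite -(ler_pXn2r (ltn0Sn 1)) ?nnegrE ?mulr_ge0 ?vnorm_ge0 //.
  by rewrite exprMn !vnorm_sq.
rewrite -(ler_pM2r xp); apply: le_trans X1; apply: le_trans (vnorm_X_ge x).
by apply: le_trans (lerB M1 (lexx _)); nra.
Qed.

End Eigenvalues.

Variable lam : R.
Hypotheses (lam_ge : 5 / 8 * K - 2 * d <= `|lam|) (lam_le : `|lam| <= 5 / 4 * K).

(* If [w] were an approximate eigenvector, [M] restricted to the complement of [u] and
   [w] would be too small, by the Frobenius bound, to reach the Rayleigh quotient at [o]. *)
Lemma unit_gap w : dot u w = 0 -> dot w w = 1 -> 2 * d <= vnorm (M *m w - lam *: w).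
Proof.
have d0 := d_gt0; have dK := d_le; have l0 := l_ge; have lam0 := lam_ge; have lam1 := lam_le.
move=> uw ww; rewrite leNgt; apply/negP => small.
have [r MwE rs] : exists2 r, M *m w = lam *: w + r & vnorm r < 2 * d.
  by exists (M *m w - lam *: w); rewrite // addrC subrK.
have wn : vnorm w = 1 by exact: vnorm_unit.
have Mw : 5 / 8 * K - 4 * d <= vnorm (M *m w).
  rewrite MwE -[r]opprK; apply: le_trans (vnormB_ge _ _).
  by rewrite vnormZ vnormN wn mulr1; lra.
pose c := dot o w; pose v := o - c *: w.
have wv : dot w v = 0 by rewrite /v !dotE ww (dotC w o) -/c; ring.
have uv : dot u v = 0 by rewrite /v !dotE uw u_orth_o; ring.
have vv : dot v v = 1 - c ^+ 2 by rewrite /v !dotE ww o_unit (dotC w o) -/c; ring.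
have oE : o = c *: w + v by rewrite addrC subrK.
clearbody v.
(* Removing about [(5 / 8 K)^2] twice from [3 K^2] leaves [71 / 32 K^2], short of [(3 / 2 K)^2] by
   [K^2 / 32]. This slack must absorb [40 d K], whence the shape of [d_le]. *)
have Mv : dot (M *m v) (M *m v) <= dot v v * (3 / 2 * K - 10 * d) ^+ 2.
  apply: le_trans (frob_bessel3 M u_unit ww uw uv wv) _.
  rewrite ler_wpM2l ?dot_ge0 // -!vnorm_sq Mu vnormZ vnorm_unit // mulr1.
  have : (5 / 8 * K - 4 * d) ^+ 2 <= vnorm (M *m w) ^+ 2 by apply: lerXn2r; rewrite ?nnegrE; lra.
  have : (5 / 8 * K - 4 * d) ^+ 2 <= `|l| ^+ 2.
    by have := ler_norm l; move=> ?; apply: lerXn2r; rewrite ?nnegrE; lra.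
  by move: M_frob; nra.
have Mv1 : vnorm (M *m v) <= vnorm v * (3 / 2 * K - 10 * d).
  rewrite -(ler_pXn2r (ltn0Sn 1)) ?nnegrE ?mulr_ge0 ?vnorm_ge0 //; last by lra.
  by rewrite exprMn !vnorm_sq.
have dvMw : dot v (M *m w) = dot v r by rewrite MwE !dotE (dotC v w) wv; ring.
have : dot o (M *m o) = c ^+ 2 * (lam + dot w r) + 2 * c * dot v r + dot v (M *m v).
  rewrite {1 2}oE mulmxDr -scalemxAr !dotE -(dot_mulmx_sym w v M_sym) (dotC (M *m w) v) dvMw.
  by rewrite MwE !dotE ww; ring.
have b1 : `|dot w r| <= 2 * d.
  by apply: le_trans (norm_dot _ _) _; rewrite wn mul1r ltW.
have b2 : `|dot v r| <= vnorm v * (2 * d).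
  by apply: le_trans (norm_dot _ _) _; rewrite ler_wpM2l ?vnorm_ge0 ?ltW.
have b3 : dot v (M *m v) <= vnorm v ^+ 2 * (3 / 2 * K - 10 * d).
  apply: le_trans (ler_norm _) _; apply: le_trans (norm_dot _ _) _.
  by rewrite expr2 -mulrA ler_wpM2l ?vnorm_ge0.
have vc : vnorm v ^+ 2 = 1 - c ^+ 2 by rewrite vnorm_sq.
have b4 : 2 * c * dot v r <= 2 * d.
  apply: le_trans (ler_norm _) _; rewrite !normrM ger0_norm //.
  have : 2 * `|c| * vnorm v <= 1.
    by have := sqr_ge0 (`|c| - vnorm v); rewrite sqrrB vc real_normK ?num_real //; lra.
  have := normr_ge0 c; have := vnorm_ge0 v; have := normr_ge0 (dot v r); nra.
have b5 : c ^+ 2 * (lam + dot w r) <= c ^+ 2 * (3 / 2 * K - 10 * d).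
  rewrite ler_wpM2l ?sqr_ge0 //; have := ler_norm (dot w r); have := ler_norm lam; lra.
(* The bounds add up to [3 / 2 K - 8 d], which is below the Rayleigh quotient at [o]. *)
move: Mo => Mo' Moe; move: b3; rewrite vc => b3.
lra.
Qed.

Lemma gap w : dot u w = 0 -> 2 * d * vnorm w <= vnorm (M *m w - lam *: w).
Proof.
move=> uw; have [w0|w0] := eqVneq (vnorm w) 0; first by rewrite w0 mulr0 vnorm_ge0.
have wp : 0 < vnorm w by rewrite lt_def w0 vnorm_ge0.
have := @unit_gap ((vnorm w)^-1 *: w).
rewrite !dotE uw mulr0 mulrA -expr2 -vnorm_sq -exprMn mulVf // expr1n.
move=> /(_ erefl erefl); rewrite -scalemxAr (scalerA lam) (mulrC lam) -scalerA -scalerBr vnormZ.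
by rewrite gtr0_norm ?invr_gt0 // [_^-1 * _]mulrC ler_pdivlMr.
Qed.

(** Let [w] be the part of [y] orthogonal to [u]. Then [(M - lam) w] is the projection of [- E y]
    off [u], of norm at most [|E u| + d |w|], while [gap] bounds it below by [2 d |w|]. Hence
    [d |w| <= |E u|]. *)
Lemma eigenvector_perturb y : X *m y = lam *: y -> dot y y = 1 -> 0 <= dot y u ->
  dot (y - u) (y - u) <= 2 * (d^-1) ^+ 2 * dot (E *m u) (E *m u).
Proof.
have d0 := d_gt0; have dK := d_le; move=> Xy yy; set a := dot y u => a0; pose w := y - a *: u.
have uw : dot u w = 0 by rewrite /w !dotE u_unit (dotC u) -/a; ring.
have yE : y = a *: u + w by rewrite addrC subrK.
have ww : dot w w = 1 - a ^+ 2 by rewrite /w !dotE u_unit yy (dotC u) -/a; ring.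
have a1 : a <= 1 by have := dot_ge0 w; rewrite ww; nra.
have My : M *m y = (a * l) *: u + M *m w.
  by rewrite {1}yE mulmxDr -scalemxAr Mu scalerA.
have yu : dot y u = a by [].
clearbody w a; pose r := M *m w - lam *: w.
have ur : dot u r = 0.
  by rewrite /r !dotE -dot_mulmx_sym // Mu !dotE uw; ring.
have rE : r = - (E *m y) - ((l - lam) * a) *: u.
  rewrite mulmxBl Xy My /r {1}yE; move: (M *m w) => z.
  by apply/colP => i; rewrite !mxE; ring.
have g := gap uw; rewrite -/r in g; clearbody r.
have rEy : vnorm r <= vnorm (E *m y).
  have [r0|r0] := eqVneq (vnorm r) 0; first by rewrite r0 vnorm_ge0.
  have rp : 0 < vnorm r by rewrite lt_def r0 vnorm_ge0.
  rewrite -(ler_pM2l rp) -expr2 vnorm_sq {2}rE !dotE (dotC r u) ur mulr0 subr0.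
  by apply: le_trans (ler_norm _) _; rewrite normrN norm_dot.
have Ey : vnorm (E *m y) <= vnorm (E *m u) + d * vnorm w.
  rewrite {1}yE mulmxDr; apply: le_trans (vnormD _ _) _; apply: lerD => //.
  rewrite -scalemxAr vnormZ ger0_norm // ler_piMl ?vnorm_ge0 //.
have wb : vnorm w <= d^-1 * vnorm (E *m u).
  by rewrite mulrC ler_pdivlMr //; lra.
have -> : dot (y - u) (y - u) = 2 - 2 * a.
  by rewrite !dotE u_unit yy (dotC u) yu; ring.
(* The sign choice enters here: [1 - a <= 1 - a^2] needs [0 <= a <= 1]. *)
apply: (@le_trans _ _ (2 * vnorm w ^+ 2)); first by rewrite vnorm_sq ww; nra.
rewrite -mulrA ler_pM2l // -(vnorm_sq (E *m u)) -exprMn lerXn2r ?nnegrE ?vnorm_ge0 //.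
by rewrite mulr_ge0 ?vnorm_ge0 // invr_ge0 ltW.
Qed.

End Perturbation.

(** * Operator norm of the noise from its cut norm *)

Section NoiseNorm.
Variables (R : realType) (p : R) (s : nat) (B : 'M[bool]_(s.*2)).
Hypotheses (p_ge0 : 0 <= p) (p_le1 : p <= 1).
Local Notation n := (s.*2).
Local Notation E := (noise p B).

Lemma noise_sym : E^T = E.
Proof. by apply/matrixP => i j; rewrite mxE noiseC. Qed.

(* Every column of the noise is a combination of two indicator vectors, so the cut norm
   controls the bilinear form of the noise at its own columns. *)
Lemma noise_col_cut a (k l : 'I_n) :
  (forall S T : {set 'I_n},
     `|\sum_i \sum_j (i \in S)%:R * (j \in T)%:R * E i j| <= a) ->
  `|\sum_i \sum_j E i k * E j l * E i j| <= 4 * a.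
Proof.
move=> cut; pose S k := [set i : 'I_n | 0 < Mhat R s B i k].
pose T (k : 'I_n) := [set i : 'I_n | (1 <= ndist i k <= s.-1)%N].
have En i k' : E i k' = (i \in S k')%:R - p * (i \in T k')%:R.
  rewrite noiseE Mhat_01 !inE; congr (_ - _); rewrite mxE.
  by case: ifP => _; rewrite ?mulr1 ?mulr0.
pose b (S T : {set 'I_n}) := \sum_i \sum_j (i \in S)%:R * (j \in T)%:R * E i j.
have -> : \sum_i \sum_j E i k * E j l * E i j =
    b (S k) (S l) - p * b (T k) (S l) - p * b (S k) (T l) + p ^+ 2 * b (T k) (T l).
  rewrite /b !mulr_sumr -!sumrB -big_split; apply: eq_bigr => i _ /=.
  rewrite !mulr_sumr -!sumrB -big_split; apply: eq_bigr => j _ /=.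
  by rewrite (En i k) (En j l); ring.
have h S' T' : `|b S' T'| <= a by exact: cut.
have a0 : 0 <= a by exact: le_trans (normr_ge0 _) (h finset.set0 finset.set0).
have pb S' T' : `|p * b S' T'| <= a.
  by apply: le_trans (h S' T'); rewrite normrM ger0_norm // ler_piMl.
have ppb S' T' : `|p ^+ 2 * b S' T'| <= a.
  by apply: le_trans (pb S' T'); rewrite expr2 -mulrA normrM ger0_norm // ler_piMl.
have := h (S k) (S l); have := pb (T k) (S l); have := pb (S k) (T l); have := ppb (T k) (T l).
rewrite !ler_norml => /andP[? ?] /andP[? ?] /andP[? ?] /andP[? ?]; apply/andP; split; lra.
Qed.

Lemma noise_frob2 a :
  (forall S T : {set 'I_n},
     `|\sum_i \sum_j (i \in S)%:R * (j \in T)%:R * E i j| <= a) ->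
  frob (E *m E) <= 4 * a * n%:R ^+ 2.
Proof.
move=> cut; have -> : frob (E *m E) =
    \sum_k \sum_l E l k * (\sum_i \sum_j E i l * E j k * E i j).
  rewrite /frob exchange_big; apply: eq_bigr => k _.
  transitivity (\sum_i \sum_l \sum_j E l k * (E i l * E j k * E i j)).
    apply: eq_bigr => i _; rewrite mxE expr2 mulr_suml exchange_big.
    rewrite exchange_big /=; apply: eq_bigr => l _.
    by rewrite mulr_sumr; apply: eq_bigr => j _; ring.
  rewrite exchange_big; apply: eq_bigr => l _; rewrite mulr_sumr.
  by apply: eq_bigr => i _; rewrite mulr_sumr.
apply: (@le_trans _ _ (\sum_(k < n) \sum_(l < n) 4 * a)); last first.
  by rewrite !sumr_const !card_ord -!(mulr_natr (4 * a)) -mulr_natr; lra.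
apply: ler_sum => k _; apply: ler_sum => l _; apply: le_trans (ler_norm _) _.
rewrite normrM; have := noise_col_cut l k cut; have := noise_max p_ge0 p_le1 B l k.
have := normr_ge0 (E l k).
set c := `|\sum_(_ < _) _|; have c0 : 0 <= c by exact: normr_ge0.
nra.
Qed.

(** The factor 1/64 is chosen so that [noise_frob2] yields [c^4 n^4 / 16], which is [(c s)^4]. *)
Lemma noise_opnorm c : 0 <= c ->
  (forall S T : {set 'I_n},
     `|\sum_i \sum_j (i \in S)%:R * (j \in T)%:R * E i j| <= c ^+ 4 / 64 * n%:R ^+ 2) ->
  forall x, vnorm (E *m x) <= c * s%:R * vnorm x.
Proof.
move=> c0 cut x; rewrite -(ler_pXn2r (ltn0Sn 3)) ?nnegrE ?vnorm_ge0 //; last first.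
  by rewrite !mulr_ge0 ?vnorm_ge0.
rewrite exprMn; apply: le_trans (sym_vnorm4 x noise_sym) _.
rewrite ler_wpM2r ?exprn_ge0 ?vnorm_ge0 //; apply: le_trans (noise_frob2 cut) _.
by rewrite le_eqVlt natr_double; apply/orP; left; apply/eqP; field.
Qed.

End NoiseNorm.

(** * Inversions *)

Section Kendall.
Variables (R : realType) (n : nat).

(** Sending a pair of positions to the pair of their values is injective. Ties are included because
    sorting gives weak inequalities only; the bound thus holds for every sorting permutation. *)
Lemma kendall_le_inversions (y : 'cV[R]_n) (sigma : 'S_n) : sorts_desc R n y sigma ->
  (kendall n sigma <= #|[set ab : 'I_n * 'I_n | (ab.1 < ab.2)%N & (y ab.1 0 <= y ab.2 0)%R]|)%N.
Proof.
move=> ys; rewrite /kendall.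
rewrite -(card_imset _ (f := fun ij : 'I_n * 'I_n => (sigma ij.2, sigma ij.1))); last first.
  by move=> [i j] [i' j'] [/perm_inj -> /perm_inj ->].
apply: subset_leq_card; apply/fintype.subsetP => _ /imsetP[[i j] /= + ->].
by rewrite !inE /= => /andP[ij ->]; rewrite ys // ltnW.
Qed.

Lemma kendall_le_sq (sigma : 'S_n) : (kendall n sigma <= n * n)%N.
Proof. by rewrite (leq_trans (max_card _)) // card_prod card_ord. Qed.

Variables (y v : 'cV[R]_n) (t : R) (d : nat).
Hypotheses (t_gt0 : 0 < t)
  (v_sep : forall i j : 'I_n, (i + d < j)%N -> 2 * t <= v i 0 - v j 0).

Definition far : {set 'I_n} := [set i | t <= `|y i 0 - v i 0|].

Lemma card_far : #|far|%:R * t ^+ 2 <= \sum_i (y i 0 - v i 0) ^+ 2.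
Proof.
rewrite -sum1_card natr_sum mulr_suml [leRHS](bigID (mem far)) /=.
apply: ler_wpDr; first by apply: sumr_ge0 => *; exact: sqr_ge0.
apply: ler_sum => i; rewrite inE mul1r => ti.
by rewrite -[leRHS]real_normK ?num_real // lerXn2r ?nnegrE // ltW.
Qed.

(** If neither end of a pair is far and the ends are more than [d] apart, the gap [2 * t] survives
    both displacements and the pair is not inverted. The other pairs have a far end or lie within
    [d] of the diagonal. *)
Lemma card_inversions :
  (#|[set ab : 'I_n * 'I_n | (ab.1 < ab.2)%N & (y ab.1 0 <= y ab.2 0)%R]|
     <= n * (2 * #|far| + d.+1))%N.
Proof.
set Q := [set _ | _ & _].
pose near_ := [set ab : 'I_n * 'I_n | (ab.1 < ab.2 <= ab.1 + d)%N].
have sub : Q \subset finset.setX far (finset.setTfor 'I_n) :|: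
    finset.setX (finset.setTfor 'I_n) far :|: near_.
  apply/fintype.subsetP => -[a b]; rewrite !inE /= => /andP[ab yab]; rewrite andbT ab /=.
  have [fa|fa] := leP t `|y a 0 - v a 0|; first by [].
  have [fb|fb] := leP t `|y b 0 - v b 0|; first by rewrite orbT.
  rewrite /= leqNgt; apply/negP => /v_sep.
  by move: fa fb yab; rewrite !ltr_norml => /andP[? ?] /andP[? ?]; lra.
have card_near : (#|near_| <= n * d.+1)%N.
  pose f (ab : 'I_n * 'I_n) : 'I_n * 'I_d.+1 := (ab.1, inord (ab.2 - ab.1)).
  rewrite -(card_in_imset (f := f)).
    by rewrite (leq_trans (max_card _)) // card_prod !card_ord.
  move=> [a b] [a' b']; rewrite !inE /= => /andP[ab bd] /andP[ab' bd'] [aa].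
  move: ab' bd'; rewrite -aa => ab' bd' /(congr1 val) /=.
  rewrite !inordK ?ltnS ?leq_subLR // => e; congr (_, _); apply: val_inj => /=.
  by rewrite -(subnKC (ltnW ab)) e subnKC // ltnW.
apply: leq_trans (subset_leq_card sub) _.
apply: leq_trans (leq_card_setU _ _) _; rewrite mulnDr leq_add //.
apply: leq_trans (leq_card_setU _ _) _; rewrite !cardsX cardsT card_ord.
by rewrite mulnCA mul2n -addnn (mulnC n).
Qed.

End Kendall.

(** * Assembly *)

Lemma cube_le_pow2 (R : realType) n : (16 <= n)%N -> 3 * 2 ^- n <= n%:R ^- 3 :> R.
Proof.
move=> /subnK <-; set k := (n - 16)%N; clearbody k.
have h : 3 * (k%:R + 16) ^+ 3 <= 2 ^+ k * (2 ^+ 4) ^+ 4 :> R.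
  elim: k => [|k IH]; first by rewrite add0r expr0; lra.
  rewrite (exprS 2 k) -(natr1 k) -[leRHS]mulrA; have : 0 <= k%:R :> R by [].
  move: IH; set x := k%:R; set z := 2 ^+ k * _ => IH x0.
  have : (x + 1 + 16) ^+ 3 <= 2 * (x + 16) ^+ 3 by nra.
  lra.
rewrite ler_pdivrMr ?exprn_gt0 // mulrC ler_pdivlMr; last by rewrite exprn_gt0 // ltr0n addnC.
by rewrite natrD exprD -(exprM 2 4 4) in h *.
Qed.

Section Assembly.
Variables (R : realType) (p : R).
Hypotheses (p_gt0 : 0 < p) (p_lt1 : p < 1).

(** Turns [d_le] into an equality for [K = p * s] and [d = tol * s]. *)
Definition tol : R := p / (32 * 40).

Lemma tol_gt0 : 0 < tol.
Proof. by rewrite divr_gt0 // mulr_gt0. Qed.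

Lemma tolE : 32 * (40 * tol) = p.
Proof. by rewrite /tol; field. Qed.

(** The cut-norm level at which [noise_opnorm] gives the bound [tol * s]. *)
Definition cut_tol : R := tol ^+ 4 / 64.

Lemma cut_tol_gt0 : 0 < cut_tol.
Proof. by rewrite divr_gt0 // exprn_gt0 // tol_gt0. Qed.

Definition uhat s : 'cV[R]_(s.*2) := (vnorm (uvec R s))^-1 *: uvec R s.

Definition onehat s : 'cV[R]_(s.*2) := (Num.sqrt (s.*2)%:R)^-1 *: const_mx 1.

Section Size.
Variable s : nat.
Hypothesis s_big : 32 * 60 <= s%:R :> R.
Local Notation n := (s.*2).

Lemma size_gt0 : (0 < s)%N.
Proof. by rewrite -(ltr0n R); have := s_big; lra. Qed.

Lemma vnorm_u_gt0 : 0 < vnorm (uvec R s).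
Proof. by rewrite sqrtr_gt0 (lt_le_trans _ (dot_u_ge R size_gt0)) // ltr0n size_gt0. Qed.

Lemma uhat_unit : dot (uhat s) (uhat s) = 1.
Proof.
by rewrite !dotE -vnorm_sq mulrA -expr2 -exprMn mulVf ?expr1n // gt_eqF ?vnorm_u_gt0.
Qed.

Lemma dot_const1 (x : 'cV[R]_n) : dot x (const_mx 1) = \sum_i x i 0.
Proof. by apply: eq_bigr => i _; rewrite mxE mulr1. Qed.

Lemma onehat_dot (x y : 'cV[R]_n) :
  (Num.sqrt n%:R)^-1 * ((Num.sqrt n%:R)^-1 * dot x y) = dot x y / n%:R.
Proof. by rewrite mulrA -expr2 exprVn sqr_sqrtr // mulrC. Qed.

Lemma onehat_unit : dot (onehat s) (onehat s) = 1.
Proof.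
rewrite !dotE onehat_dot dot_const1; under eq_bigr do rewrite mxE.
by rewrite sumr_const card_ord divff // pnatr_eq0 -lt0n double_gt0 size_gt0.
Qed.

Lemma uhat_onehat : dot (uhat s) (onehat s) = 0.
Proof. by rewrite !dotE dot_const1 sum_u ?mulr0 ?size_gt0. Qed.

Lemma Mmodel_uhat : Mmodel R p s *m uhat s = ulambda s p *: uhat s.
Proof. by rewrite -scalemxAr Mmodel_u ?size_gt0 // !scalerA mulrC. Qed.

Lemma Mmodel_sym : (Mmodel R p s)^T = Mmodel R p s.
Proof. by apply/matrixP => i j; rewrite mxE MmodelC. Qed.

Lemma Mhat_sym B : (Mhat R s B)^T = Mhat R s B.
Proof. by apply/matrixP => i j; rewrite mxE MhatC. Qed.

(** The quotient is [3 / 2 * p * (s - 1)]; the lost [3 / 2 * p] is at most [tol * s] exactly from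
    [s = 32 * 60] on. *)
Lemma Mmodel_onehat : 3 / 2 * (p * s%:R) - tol * s%:R <=
  dot (onehat s) (Mmodel R p s *m onehat s).
Proof.
have s1 : 0 < s%:R :> R by rewrite ltr0n size_gt0.
rewrite -scalemxAr !dotE onehat_dot dotC dot_const1.
have -> : \sum_i (Mmodel R p s *m (const_mx 1 : 'cV[R]_n)) i 0 = \sum_i \sum_j Mmodel R p s i j.
  by apply: eq_bigr => i _; rewrite mxE; apply: eq_bigr => j _; rewrite [const_mx _ _ _]mxE mulr1.
rewrite Mmodel_total ?size_gt0 // natr_double.
have -> : 3 * p * s%:R * (s%:R - 1) / (2 * s%:R) = 3 / 2 * p * (s%:R - 1) by field; lra.
by rewrite -tolE; have := tol_gt0; have := s_big; nra.
Qed.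

Variable B : 'M[bool]_n.
Hypothesis cut : forall S T : {set 'I_n},
  `|\sum_i \sum_j (i \in S)%:R * (j \in T)%:R * noise p B i j| <= cut_tol * n%:R ^+ 2.
Hypothesis noise_u : \sum_i (\sum_j noise p B i j * uvec R s j 0) ^+ 2 <= 256 * n%:R ^+ 2.

Lemma eigenvector_close (lam : R) (y : 'cV[R]_n) :
  is_lambda2 R _ (Mhat R s B) lam -> Mhat R s B *m y = lam *: y ->
  \sum_i (y i 0) ^+ 2 = 1 -> 0 <= \sum_i y i 0 * uvec R s i 0 ->
  \sum_i (y i 0 - uhat s i 0) ^+ 2 <= 64 * 64 / (tol ^+ 2 * n%:R).
Proof.
move=> [sp [cX [srt ->]]] Xy yy yu.
have s0 := size_gt0; have sb := s_big; have t0 := tol_gt0; have p0 := p_gt0.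
have s1 : 0 < s%:R :> R by rewrite ltr0n.
have n1 : (1 < n)%N by rewrite -[1%N]/(0.*2.+1) ltn_Sdouble.
pose K := p * s%:R; pose d := tol * s%:R.
have d0 : 0 < d by rewrite mulr_gt0.
have dK : 32 * (40 * d) <= K by rewrite /K /d -tolE; lra.
have E_small : forall x, vnorm ((Mhat R s B - Mmodel R p s) *m x) <= d * vnorm x.
  by apply: noise_opnorm => //; rewrite ltW.
have l_ge : 5 / 8 * K - d <= ulambda s p.
  apply: le_trans (ulambda_ge s0 (ltW p0)); rewrite /K /d -tolE; nra.
have M_frob : frob (Mmodel R p s) <= 3 * K ^+ 2.
  by rewrite Mmodel_frob // /K; nra.
have lam_le := lambda2_le (Mhat_sym B) d0 dK M_frob E_small cX srt n1.
have lam_ge := lambda2_ge Mmodel_sym (Mhat_sym B) d0 dK uhat_unit onehat_unit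
  uhat_onehat Mmodel_uhat l_ge Mmodel_onehat E_small cX srt n1.
have yy1 : dot y y = 1 by rewrite dot_sq.
have yu0 : 0 <= dot y (uhat s).
  by rewrite !dotE mulr_ge0 // invr_ge0 vnorm_ge0.
have := eigenvector_perturb Mmodel_sym d0 dK uhat_unit onehat_unit uhat_onehat
  Mmodel_uhat l_ge M_frob Mmodel_onehat E_small lam_ge lam_le Xy yy1 yu0.
have -> : dot (y - uhat s) (y - uhat s) = \sum_i (y i 0 - uhat s i 0) ^+ 2.
  by rewrite dot_sq; apply: eq_bigr => i _; rewrite [(y - _) i 0]mxE [X in _ + X]mxE.
move=> h; apply: le_trans h _.
have -> : dot ((Mhat R s B - Mmodel R p s) *m uhat s) ((Mhat R s B - Mmodel R p s) *m uhat s)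
   = (\sum_i (\sum_j noise p B i j * uvec R s j 0) ^+ 2) / dot (uvec R s) (uvec R s).
  rewrite -scalemxAr !dotE mulrA -expr2 exprVn vnorm_sq mulrC dot_sq; congr (_ / _).
  by apply: eq_bigr => i _; rewrite mxE.
(* Normalising [u] divides by [|u|^2 >= s]; with [n = 2 s] the result is [64 * 64 / (tol^2 n)]. *)
apply: (@le_trans _ _ (2 * d^-1 ^+ 2 * (256 * n%:R ^+ 2 / s%:R))).
  apply: ler_wpM2l; first by rewrite mulr_ge0 // exprn_ge0 // invr_ge0 ltW.
  apply: ler_pM => //; first by apply: sumr_ge0 => *; exact: sqr_ge0.
    by rewrite invr_ge0 dot_ge0.
  by rewrite lef_pV2 ?posrE // ?dot_u_ge // (lt_le_trans s1) // dot_u_ge.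
rewrite natr_double /d le_eqVlt; apply/orP; left; apply/eqP; field.
by rewrite !gt_eqF.
Qed.

Lemma kendall_bound (lam : R) (y : 'cV[R]_n) (sigma : 'S_n) :
  is_lambda2 R _ (Mhat R s B) lam -> Mhat R s B *m y = lam *: y ->
  \sum_i (y i 0) ^+ 2 = 1 -> 0 <= \sum_i y i 0 * uvec R s i 0 ->
  sorts_desc R _ y sigma ->
  (kendall _ sigma)%:R <= (2 * (64 * 64 / tol ^+ 2) + 5) * n%:R `^ (9%:R / 5%:R).
Proof.
move=> hl Xy yy yu ys; have s0 := size_gt0; have t0 := tol_gt0.
have n1 : 1 <= n%:R :> R by rewrite ler1n double_gt0.
(* All powers of [n] involved are integer powers of its tenth root [a]: the target is [a^18] and the
   displacement threshold [a^-9]. *)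
pose a : R := n%:R `^ 10^-1.
have a10 : n%:R = a ^+ 10.
  by rewrite -powR_mulrn ?powR_ge0 // -powRrM mulVf // powRr1.
have a18 : n%:R `^ (9%:R / 5%:R) = a ^+ 18.
  by rewrite -powR_mulrn ?powR_ge0 // -powRrM; congr (_ `^ _); field.
have a1 : 1 <= a.
  by have := @ge0_ler_powR R 10^-1 ltac:(by []) 1 n%:R; rewrite powR1; apply; rewrite ?nnegrE.
have a0 : 0 < a by lra.
clearbody a; pose t := a ^- 9; have tp : 0 < t by rewrite invr_gt0 exprn_gt0.
(* Indices more than [d] apart have entries of [uhat] separated by at least
   [(4 a^8)^2 / (5 a^25) = 16 / 5 a^-9], and the factor 4 brings this above [2 * t]. *)
pose d := Num.truncn (4 * a ^+ 8).
have /andP[d1 d2] : d%:R <= 4 * a ^+ 8 < d.+1%:R.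
  by apply: truncn_itv; rewrite mulr_ge0 // exprn_ge0 // ltW.
have vu : vnorm (uvec R s) <= a ^+ 5.
  rewrite -(ler_pXn2r (ltn0Sn 1)) ?nnegrE ?vnorm_ge0 ?exprn_ge0 ?(ltW a0) //.
  by rewrite vnorm_sq -exprM -a10 dot_u_le.
have sep (i j : 'I_n) : (i + d < j)%N -> 2 * t <= uhat s i 0 - uhat s j 0.
  move=> ij; have ij' : (i <= j)%N by rewrite ltnW // (leq_ltn_trans (leq_addr d i)).
  rewrite [uhat s i 0]mxE [uhat s j 0]mxE -mulrBr.
  apply: (@le_trans _ _ ((a ^+ 5)^-1 * ((4 * a ^+ 8) ^+ 2 / (5 * n%:R ^+ 2)))).
    rewrite a10 /t.
    have -> : (a ^+ 5)^-1 * ((4 * a ^+ 8) ^+ 2 / (5 * (a ^+ 10) ^+ 2)) = 16 / 5 * a ^- 9.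
      by field; rewrite gt_eqF.
    by rewrite ler_wpM2r ?invr_ge0 ?exprn_ge0 ?(ltW a0) //; lra.
  apply: ler_pM; rewrite ?invr_ge0 ?exprn_ge0 ?(ltW a0) //.
  - by rewrite divr_ge0 ?sqr_ge0 // mulr_ge0 ?sqr_ge0.
  - by rewrite lef_pV2 ?posrE ?exprn_gt0 // vnorm_u_gt0.
  apply: le_trans (uvec_gap R s0 ij'); rewrite ler_wpM2r //.
  apply: lerXn2r; rewrite ?nnegrE ?mulr_ge0 ?exprn_ge0 ?(ltW a0) //.
  by rewrite (le_trans (ltW d2)) // ler_nat ltn_subRL.
have close := eigenvector_close hl Xy yy yu.
have inv := leq_trans (kendall_le_inversions ys) (card_inversions y sep).
have far_le := le_trans (card_far y (uhat s) tp) close.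
have Nn : #|far y (uhat s) t|%:R * n%:R <= 64 * 64 / tol ^+ 2 * a ^+ 18.
  have n0 : 0 < n%:R :> R by lra.
  move: far_le; set N := #|_|%:R; rewrite (_ : t = a ^- 9) // => far_le.
  have -> : N * n%:R = N * (a ^- 9) ^+ 2 * (a ^+ 18 * n%:R) by field; rewrite gt_eqF.
  have -> : 64 * 64 / tol ^+ 2 * a ^+ 18 =
      64 * 64 / (tol ^+ 2 * n%:R) * (a ^+ 18 * n%:R).
    by field; rewrite !gt_eqF.
  by rewrite ler_wpM2r // mulr_ge0 ?exprn_ge0 // ltW.
rewrite a18; apply: (@le_trans _ _ (n * (2 * #|far y (uhat s) t| + d.+1))%:R).
  by rewrite ler_nat.
rewrite natrM natrD natrM -(natr1 d) mulrDr mulrDl.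
have : n%:R * (d%:R + 1) <= 5 * a ^+ 18.
  rewrite a10 (exprD a 10 8) mulrCA ler_wpM2l ?exprn_ge0 ?(ltW a0) //.
  have : 1 <= a ^+ 8 by rewrite exprn_ege1.
  by move: d1; lra.
by move: Nn; lra.
Qed.

End Size.
End Assembly.

Theorem theorem4 (R : realType) (p : R) (hp0 : 0 < p) (hp1 : p < 1) :
  exists C : R, 0 < C /\
  forall s : nat, (0 < s)%N ->
    1 - ((s.*2)%:R ^- 3) <=
    Prob R p s (fun B : 'M[bool]_(s.*2) =>
      forall (lam : R) (y : 'cV[R]_(s.*2)) (sigma : 'S_(s.*2)),
        is_lambda2 R _ (Mhat R s B) lam ->
        Mhat R s B *m y = lam *: y ->
        \sum_i (y i 0) ^+ 2 = 1 ->
        0 <= \sum_i y i 0 * uvec R s i 0 ->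
        sorts_desc R _ y sigma ->
        (kendall _ sigma)%:R <= C * ((s.*2)%:R `^ (9%:R / 5%:R))).
Proof.
have p0 := ltW hp0; have p1 := ltW hp1; have eta0 := cut_tol_gt0 hp0.
pose C1 : R := 2 * (64 * 64 / tol p ^+ 2) + 5.
have C1_gt0 : 0 < C1.
  by rewrite /C1 ltr_wpDl // mulr_ge0 // divr_ge0 ?sqr_ge0 // mulr_ge0.
(* From [T] on, both [s_big] and the requirement [64 <= eta^2 n] of the concentration bound hold. *)
pose T : R := 32 * 60 + 64 / cut_tol p ^+ 2.
have T0 : 32 * 60 <= T by rewrite lerDl divr_ge0 ?sqr_ge0.
exists (C1 + (2 * T) ^+ 2); split; first by rewrite ltr_wpDr ?sqr_ge0.
move=> s s0; have n1 : 1 <= (s.*2)%:R :> R by rewrite ler1n double_gt0.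
have [sT|Ts] := ltP s%:R T.
  (* Below the threshold the event is certain: the Kendall distance is at most [n^2 <= (2 T)^2],
     which [C] includes. *)
  apply: le_trans (Prob_ge p0 p1 (f := fun=> 0) _ _) => //.
    under eq_bigr do rewrite mulr0; rewrite big1 // subr0.
    by rewrite lerBlDr lerDl invr_ge0 exprn_ge0.
  move=> B; left=> lam y sigma _ _ _ _ _.
  have pw : 1 <= (s.*2)%:R `^ (9%:R / 5%:R) :> R.
    have := @ge0_ler_powR R (9%:R / 5%:R) ltac:(by rewrite divr_ge0) 1 (s.*2)%:R.
    by rewrite powR1; apply; rewrite ?nnegrE.
  apply: (@le_trans _ _ ((s.*2)%:R * (s.*2)%:R)).
    by rewrite -natrM ler_nat kendall_le_sq.
  apply: (@le_trans _ _ ((2 * T) ^+ 2)).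
    rewrite -expr2 natr_double; apply: lerXn2r; rewrite ?nnegrE; try lra.
    by rewrite mulr_ge0.
  have TT := sqr_ge0 (2 * T).
  by apply: (@le_trans _ _ (C1 + (2 * T) ^+ 2)); [rewrite lerDr ltW | rewrite ler_peMr //; lra].
have s_big : 32 * 60 <= s%:R :> R by exact: le_trans Ts.
have n16 : (16 <= s.*2)%N.
  by rewrite -(ler_nat R) natr_double; lra.
have eta_n : 64 <= cut_tol p ^+ 2 * (s.*2)%:R.
  rewrite mulrC -ler_pdivrMr ?exprn_gt0 // natr_double.
  by move: Ts; rewrite /T; set z := _ / _; lra.
have conc := noise_concentration p0 p1 s0 eta0 eta_n (u_norm_max R s0).
apply: le_trans (le_trans _ conc) _.
  by rewrite lerD2l lerN2 cube_le_pow2.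
(* Monotonicity of the probability: the concentration event implies the Kendall bound for all
   admissible eigenvectors at once. *)
rewrite /Prob big_mkcond [leRHS]big_mkcond; apply: ler_sum => B _.
case: asboolP => [[cut nu]|_]; last by case: ifP => _ //; exact: weight_ge0.
case: asboolP => // bad; exfalso; apply: bad => lam y sigma hl Xy yy yu ys.
apply: le_trans (kendall_bound hp0 hp1 s_big cut nu hl Xy yy yu ys) _.
by rewrite ler_wpM2r ?powR_ge0 // lerDl sqr_ge0.
Qed.
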